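(* Let $p>1$ and let $u$ be a solution to the focusing one-dimensional wave equation $u_{tt}-u_{xx}=|u|^{p-1}u$ with smooth and compactly supported initial data $(u_0,u_1)$ at time $t=0$. Then $u$ satisfies either of the following: \begin{itemize} \item the solution $u$ blows up in finite time in the positive time direction; \item the solution $u$ is defined for all time $t\in[0,\infty)$ and satisfies \[ \lim_{t\to+\infty}\|(u(\cdot,t),u_t(\cdot,t))\|_{\dot H^1\times L^2}=+\infty. \] \end{itemize}
   Context: Here $x\in\mathbb{R}$ and $u$ is the maximal (forward in time) solution of the Cauchy problem $u_{tt}-u_{xx}=|u|^{p-1}u$, $u(\cdot,0)=u_0$, $u_t(\cdot,0)=u_1$. ''Blows up in finite time in the positive time direction'' means that its maximal forward time of existence $T_+$ is finite. The norm is $\|(f,g)\|_{\dot H^1\times L^2}^2=\int_{\mathbb{R}}(|f'(x)|^2+|g(x)|^2)\,dx$.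
   Formalization: The initial data are assumed not identically zero; for zero data the solution u = 0 is global with norm 0, so the claim as written fails for that one solution. *)

(* Defs.v *)
(* Stdlib real numbers with Coquelicot. *)
From Stdlib Require Import Reals.
From Coquelicot Require Import Coquelicot.
Open Scope R_scope.

(* Functions on space-time are written [u x t], space variable first. *)
Definition dx (u : R -> R -> R) (x t : R) : R := Derive (fun y => u y t) x.
Definition dt (u : R -> R -> R) (x t : R) : R := Derive (fun s => u x s) t.

Definition smooth (f : R -> R) : Prop := forall n x, ex_derive_n f n x.

Definition compactly_supported (f : R -> R) : Prop :=
  exists M : R, forall x : R, M < Rabs x -> f x = 0.

(* [Rpower 0 (p - 1)] is not 0 in the standard library, but the factor [v]
   makes the product vanish at [v = 0], as it should for p > 1. *)
Definition nonlinearity (p v : R) : R := Rpower (Rabs v) (p - 1) * v.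

(* w(y,t) tends to l as (y,t) tends to (x,0) with t > 0. *)
Definition initial_limit (w : R -> R -> R) (x l : R) : Prop :=
  filterlim (fun z : R * R => w (fst z) (snd z))
    (within (fun z : R * R => 0 < snd z) (locally (x, 0))) (locally l).

(* Classical solutions: C^2 on R x (0,T), C^1 up to t = 0.  The values of [u]
   at negative times are irrelevant, so at t = 0 the function [dt u] is not
   meaningful; instead u, u_x and u_t are required to extend continuously to
   t = 0 by u0, u0' and u1.  Together with u(.,0) = u0 this makes u1 the right
   time derivative of u at t = 0. *)
Record is_solution (p : R) (u0 u1 : R -> R) (T : Rbar) (u : R -> R -> R)
  : Prop := {
  solution_time : Rbar_lt 0 T;
  solution_C2 : forall x t : R, 0 < t -> Rbar_lt t T -> ex_diff_n u 2 x t;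
  solution_eq : forall x t : R, 0 < t -> Rbar_lt t T ->
    dt (dt u) x t - dx (dx u) x t = nonlinearity p (u x t);
  solution_u0 : forall x : R, u x 0 = u0 x;
  solution_u_lim : forall x : R, initial_limit u x (u0 x);
  solution_ux_lim : forall x : R, initial_limit (dx u) x (Derive u0 x);
  solution_ut_lim : forall x : R, initial_limit (dt u) x (u1 x)
}.

(* T is the maximal forward time of existence of u. *)
Definition is_maximal_solution (p : R) (u0 u1 : R -> R) (T : Rbar)
    (u : R -> R -> R) : Prop :=
  is_solution p u0 u1 T u /\
  forall (T' : Rbar) (v : R -> R -> R),
    is_solution p u0 u1 T' v ->
    (forall x t : R, 0 <= t -> Rbar_lt t T -> v x t = u x t) ->
    Rbar_le T' T.

Definition energy_density (f g : R -> R) (x : R) : R :=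
  Rabs (Derive f x) ^ 2 + Rabs (g x) ^ 2.

Definition finite_energy (f g : R -> R) : Prop :=
  ex_RInt_gen (energy_density f g) (Rbar_locally m_infty) (Rbar_locally p_infty).

(* The norm of (f,g) in \dot H^1 x L^2; meaningful when [finite_energy f g]. *)
Definition energy_norm (f g : R -> R) : R :=
  sqrt (RInt_gen (energy_density f g)
          (Rbar_locally m_infty) (Rbar_locally p_infty)).

(* Main.v *)
Require Import Defs.
From Stdlib Require Import Reals Lra Classical.
From Coquelicot Require Import Coquelicot.
Open Scope R_scope.

(** A global solution is shown either to have an energy norm that tends to
    infinity or to vanish.  Let M be large enough for the solution to live in
    the cone |x| < M + t (finite speed of propagation), write F for the
    potential |u|^(p+1) / (p+1), let S(t) be the integral over x of F(u(x,t)),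
    and let e and m = u_t u_x be the energy and momentum densities.

    The dichotomy comes from a conformal-type quantity.  The energy E, the
    integral of e, is constant, and the squared norm is 2 E + 2 S(t), so the
    point is the behaviour of S.  Let Q(t) be the integral of (M + t) e + x m.
    The conservation laws give Q' = - 2 S, and since the kinetic part of the
    integrand is nonnegative for |x| <= M + t, also Q >= - (M + t) S.  If Q is
    negative at some time t1, these two facts make - Q / (M + t)^2
    nondecreasing, so S grows at least linearly and the norm diverges
    ([potential_unbounded_of_conformal_lt_0]).  Otherwise Q >= 0 for all times,
    and then the integral of S over time is finite.

    In the second case u has to vanish for t > M.  Here the sign of the
    nonlinearity is decisive.  In the null coordinates sigma = t - x and
    tau = t + x, the wave equation says that u_tau has sigma-derivative
    proportional to f(u) with f = F', hence the tau-derivative of F(u) is a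
    positive multiple of the sigma-derivative of u_tau^2.  In the region
    tau > M the solution is zero at the outer edge sigma = -M, so the integral
    of F(u) over -M < sigma < sigma0 is nondecreasing in tau: whatever is
    there stays there, and the time integral of S would diverge.
    [potential_persists] runs this argument on slices of constant time, with
    weights in sigma and tau, which avoids changes of variables in double
    integrals.  Its mirror image treats sigma > M, and together the two regions
    contain all points with t > M ([vanishes_of_conformal_ge_0]).

    Finally, if u vanishes for t > M then E = 0, so the kinetic energy is S(t),
    which for bounded u is at most a constant times the integral of u^2.
    Gronwall's inequality for the latter, run backwards in time, shows that u
    vanishes for all t > 0 ([vanishes_of_late_vanishing]), and therefore so do
    the initial data. *)

(** * The nonlinearity and its potential *)

Definition potential (p v : R) : R := Rpower (Rabs v) (p - 1) * v ^ 2 / (p + 1).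

Lemma Rpower_gt_0 (x y : R) : 0 < Rpower x y.
Proof. apply exp_pos. Qed.

Lemma Rabs_nonlinearity_le (p B v : R) : 1 < p -> Rabs v <= B ->
  Rabs (nonlinearity p v) <= Rpower (B) (p - 1) * Rabs v.
Proof.
  intros hp hv; unfold nonlinearity.
  rewrite Rabs_mult, (Rabs_pos_eq (Rpower _ _)) by (apply Rlt_le, Rpower_gt_0).
  destruct (Req_dec v 0) as [->|h0]; [rewrite Rabs_R0; lra|].
  apply Rmult_le_compat_r; [apply Rabs_pos|].
  apply Rle_Rpower_l; [lra|split; [now apply Rabs_pos_lt|easy]].
Qed.

Lemma potential_eq (p v : R) : potential p v = v * nonlinearity p v / (p + 1).
Proof. unfold potential, nonlinearity, Rdiv; ring. Qed.

Lemma potential_ge_0 (p v : R) : 1 < p -> 0 <= potential p v.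
Proof.
  intros hp; unfold potential.
  apply Rmult_le_pos; [apply Rmult_le_pos|].
  - apply Rlt_le, Rpower_gt_0.
  - apply pow2_ge_0.
  - apply Rlt_le, Rinv_0_lt_compat; lra.
Qed.

Lemma potential_gt_0 (p v : R) : 1 < p -> v <> 0 -> 0 < potential p v.
Proof.
  intros hp hv; unfold potential.
  apply Rmult_lt_0_compat; [apply Rmult_lt_0_compat|].
  - apply Rpower_gt_0.
  - now apply pow2_gt_0.
  - apply Rinv_0_lt_compat; lra.
Qed.

Lemma potential_0 (p : R) : potential p 0 = 0.
Proof. unfold potential, Rdiv; ring. Qed.

Lemma nonlinearity_0 (p : R) : nonlinearity p 0 = 0.
Proof. unfold nonlinearity; ring. Qed.

Lemma potential_le (p B v : R) : 1 < p -> Rabs v <= B ->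
  potential p v <= Rpower (B) (p - 1) * v ^ 2.
Proof.
  intros hp hv.
  assert (h := Rabs_nonlinearity_le p B v hp hv).
  assert (hq := potential_ge_0 p v hp).
  assert (h1 : (p + 1) * potential p v = v * nonlinearity p v)
    by (rewrite potential_eq; field; lra).
  assert (h2 : v * nonlinearity p v <= Rpower (B) (p - 1) * v ^ 2).
  { eapply Rle_trans; [apply Rle_abs|]. rewrite Rabs_mult, <- (pow2_abs v).
    assert (h3 := Rabs_pos v). nra. }
  nra.
Qed.

Lemma is_derive_Rpower_abs (q v : R) : v <> 0 ->
  is_derive (fun x => Rpower (Rabs x) q) v (q * Rpower (Rabs v) q / v).
Proof.
  intros hv.
  destruct (Rtotal_order v 0) as [h|[h|h]]; [|lra|].
  - apply is_derive_ext_loc with (fun x => Rpower (- x) q).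
    + apply (filter_imp (fun x => x < 0)); [|now apply open_lt].
      intros x hx; now rewrite Rabs_left.
    + rewrite Rabs_left by easy. unfold Rpower. auto_derive; [lra|]. field; lra.
  - apply is_derive_ext_loc with (fun x => Rpower x q).
    + apply (filter_imp (fun x => 0 < x)); [|now apply open_gt].
      intros x hx; now rewrite Rabs_pos_eq by lra.
    + rewrite Rabs_pos_eq by lra. unfold Rpower. auto_derive; [lra|]. field; lra.
Qed.

Lemma Rabs_nonlinearity_le_id (p v : R) : 1 < p -> Rabs v <= 1 ->
  Rabs (nonlinearity p v) <= Rabs v.
Proof.
  intros hp hv. assert (h := Rabs_nonlinearity_le p 1 v hp hv).
  unfold Rpower in h.
  now rewrite ln_1, Rmult_0_r, exp_0, Rmult_1_l in h.
Qed.

Lemma continuity_pt_nonlinearity (p v : R) : 1 < p -> continuity_pt (nonlinearity p) v.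
Proof.
  intros hp.
  destruct (Req_dec v 0) as [->|hv].
  - apply continuity_pt_filterlim, filterlim_locally. intros eps.
    assert (he := cond_pos eps).
    exists (mkposreal (Rmin 1 eps) (Rmin_pos _ _ Rlt_0_1 he)). intros y hy.
    change (Rabs (y - 0) < Rmin 1 eps) in hy. rewrite Rminus_0_r in hy.
    change (Rabs (nonlinearity p y - nonlinearity p 0) < eps).
    rewrite nonlinearity_0, Rminus_0_r.
    assert (h1 := Rmin_l 1 eps); assert (h2 := Rmin_r 1 eps).
    assert (h3 := Rabs_nonlinearity_le_id p y hp). lra.
  - apply derivable_continuous_pt.
    exists (p * Rpower (Rabs v) (p - 1)). apply is_derive_Reals.
    unfold nonlinearity.
    evar_last.
    apply (is_derive_mult (fun x => Rpower (Rabs x) (p - 1)) (fun x => x)).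
    + now apply is_derive_Rpower_abs.
    + apply (is_derive_id (v : R_AbsRing)).
    + intros; apply Rmult_comm.
    + change (((p - 1) * Rpower (Rabs v) (p - 1) / v) * v + Rpower (Rabs v) (p - 1) * 1
              = p * Rpower (Rabs v) (p - 1)). field; easy.
Qed.

(** At 0 the derivative exists because the difference quotient of the potential is
    a multiple of the nonlinearity, which is O(h) near 0. *)
Lemma is_derive_potential (p v : R) : 1 < p ->
  is_derive (potential p) v (nonlinearity p v).
Proof.
  intros hp.
  destruct (Req_dec v 0) as [->|hv].
  - apply is_derive_Reals. intros eps he. rewrite nonlinearity_0.
    exists (mkposreal (Rmin 1 eps) (Rmin_pos _ _ Rlt_0_1 he)). intros h h0 hh.
    simpl in hh.
    assert (h1 := Rmin_l 1 eps); assert (h2 := Rmin_r 1 eps).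
    assert (h3 := Rabs_nonlinearity_le_id p h hp).
    rewrite Rplus_0_l, potential_0, potential_eq.
    replace ((h * nonlinearity p h / (p + 1) - 0) / h - 0)
      with (nonlinearity p h * / (p + 1)) by (field; lra).
    rewrite Rabs_mult, (Rabs_pos_eq (/ (p + 1))).
    2: { apply Rlt_le, Rinv_0_lt_compat; lra. }
    assert (h4 : / (p + 1) <= 1).
    { rewrite <- Rinv_1. apply Rinv_le_contravar; lra. }
    assert (h5 := Rabs_pos (nonlinearity p h)). nra.
  - unfold potential, nonlinearity.
    apply is_derive_ext with
      (fun x => Rpower (Rabs x) (p - 1) * (x ^ 2 / (p + 1)));
      [intros x; symmetry; apply Rmult_assoc|].
    evar_last.
    apply (is_derive_mult (fun x => Rpower (Rabs x) (p - 1)) (fun x => x ^ 2 / (p + 1)) v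
       ((p - 1) * Rpower (Rabs v) (p - 1) / v) (2 * v / (p + 1))).
    + now apply is_derive_Rpower_abs.
    + auto_derive; [lra|field; lra].
    + intros; apply Rmult_comm.
    + change (((p - 1) * Rpower (Rabs v) (p - 1) / v) * (v ^ 2 / (p + 1))
         + Rpower (Rabs v) (p - 1) * (2 * v / (p + 1)) = Rpower (Rabs v) (p - 1) * v).
      field; split; lra.
Qed.

Lemma continuity_pt_potential (p v : R) : 1 < p -> continuity_pt (potential p) v.
Proof.
  intros hp. apply derivable_continuous_pt. exists (nonlinearity p v).
  now apply is_derive_Reals, is_derive_potential.
Qed.

(** * Calculus in one and two variables *)

Lemma continuity_2d_pt_pow (f : R -> R -> R) (n : nat) (x t : R) :
  continuity_2d_pt f x t -> continuity_2d_pt (fun y s => f y s ^ n) x t.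
Proof.
  intros h. apply (continuity_1d_2d_pt_comp (fun z => z ^ n)); [|easy].
  apply derivable_continuous_pt, derivable_pt_pow.
Qed.

Lemma continuity_2d_pt_div_const (f : R -> R -> R) (c x t : R) :
  continuity_2d_pt f x t -> continuity_2d_pt (fun y s => f y s / c) x t.
Proof.
  intros h. apply continuity_2d_pt_mult; [easy|apply continuity_2d_pt_const].
Qed.

Lemma is_derive_Rmult (f g : R -> R) (f' g' r : R) :
  is_derive f r f' -> is_derive g r g' ->
  is_derive (fun r => f r * g r) r (f' * g r + f r * g').
Proof. intros hf hg. apply (is_derive_mult f g); try easy. intros; apply Rmult_comm. Qed.

Ltac continuity_2d :=
  repeat first
    [ assumption | apply continuity_2d_pt_const | apply continuity_2d_pt_id1
    | apply continuity_2d_pt_id2 | apply continuity_2d_pt_div_const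
    | apply continuity_2d_pt_pow | apply continuity_2d_pt_plus
    | apply continuity_2d_pt_minus | apply continuity_2d_pt_mult
    | apply continuity_2d_pt_opp ].

(** Uniform continuity turns into a bound by walking from the corner (a, c) in
    steps shorter than the modulus of continuity for the error 1: each step
    changes the value by less than 1. *)
Lemma continuity_2d_pt_bounded (f : R -> R -> R) (a b c d : R) :
  (forall x y, a <= x <= b -> c <= y <= d -> continuity_2d_pt f x y) ->
  exists B, forall x y, a <= x <= b -> c <= y <= d -> Rabs (f x y) <= B.
Proof.
  intros hf.
  destruct (uniform_continuity_2d f a b c d hf (mkposreal _ Rlt_0_1)) as [e he].
  simpl in he. assert (he0 := cond_pos e).
  assert (hn : forall n x y, a <= x <= b -> c <= y <= d ->
     x - a <= INR n * (e / 2) -> y - c <= INR n * (e / 2) ->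
     Rabs (f x y) <= Rabs (f a c) + INR n).
  { induction n as [|n IH]; intros x y hx hy hxn hyn.
    - simpl in hxn, hyn |- *. replace x with a by lra. replace y with c by lra. lra.
    - rewrite S_INR in hxn, hyn |- *.
      assert (h0 : 0 <= INR n * (e / 2))
        by (apply Rmult_le_pos; [apply pos_INR|lra]).
      assert (back : forall l r z, l <= z <= r ->
                z - l <= (INR n + 1) * (e / 2) ->
                exists z', l <= z' <= r /\ z' - l <= INR n * (e / 2) /\
                  Rabs (z - z') < e).
      { intros l r z hz hzn. exists (Rmax l (z - e / 2)). unfold Rmax.
        destruct (Rle_dec l (z - e / 2)); repeat split; try lra;
          apply Rabs_lt_between; lra. }
      destruct (back a b x hx hxn) as (x' & hx' & hxn' & hxx').
      destruct (back c d y hy hyn) as (y' & hy' & hyn' & hyy').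
      assert (h1 := IH x' y' hx' hy' hxn' hyn').
      assert (h2 := he x' y' x y hx' hy' hx hy hxx' hyy').
      assert (h3 := Rabs_triang (f x y - f x' y') (f x' y')).
      replace (f x y - f x' y' + f x' y') with (f x y) in h3 by ring. lra. }
  destruct (nfloor_ex (Rmax 0 (Rmax (b - a) (d - c) / (e / 2)))) as [n hn'].
  { apply Rmax_l. }
  exists (Rabs (f a c) + INR (S n)). intros x y hx hy.
  assert (hb : Rmax (b - a) (d - c) <= INR (S n) * (e / 2)).
  { assert (h := Rmax_r 0 (Rmax (b - a) (d - c) / (e / 2))).
    apply Rle_div_l; [lra|]. rewrite S_INR. lra. }
  assert (h1 := Rmax_l (b - a) (d - c)). assert (h2 := Rmax_r (b - a) (d - c)).
  apply hn; lra.
Qed.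

Lemma derivative_ge_0_le (f df : R -> R) (a b : R) : a <= b ->
  (forall s, a <= s <= b -> is_derive f s (df s)) ->
  (forall s, a <= s <= b -> 0 <= df s) -> f a <= f b.
Proof.
  intros hab hf hdf.
  destruct (MVT_gen f a b df) as [c [hc e]];
    rewrite ?Rmin_left, ?Rmax_right in * by easy.
  - intros s hs. apply hf; lra.
  - intros s hs. apply derivable_continuous_pt. exists (df s).
    now apply is_derive_Reals, hf.
  - assert (h := hdf c hc). nra.
Qed.

Lemma abs_sign_mult_le (s x r : R) : s * s = 1 -> Rabs x <= r -> s * x <= r.
Proof.
  intros hs hx. assert (h : (s - 1) * (s + 1) = 0) by lra.
  apply Rabs_le_between in hx.
  destruct (Rmult_integral _ _ h) as [h'|h'].
  - replace s with 1 by lra. lra.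
  - replace s with (-1) by lra. lra.
Qed.

(** * A bounded increasing cutoff *)

(** A C^1 cutoff, strictly increasing on the positive half-line.  Vanishing on the
    negative one makes a weighted integral start from zero; boundedness lets a
    lower bound for it pass to the unweighted integral. *)
Definition ramp (r : R) : R := Rmax 0 r ^ 2 / (1 + Rmax 0 r ^ 2).
Definition ramp' (r : R) : R := 2 * Rmax 0 r / (1 + Rmax 0 r ^ 2) ^ 2.

Lemma is_derive_Rmax_0_sqr (r : R) :
  is_derive (fun r => Rmax 0 r ^ 2) r (2 * Rmax 0 r).
Proof.
  destruct (Rtotal_order r 0) as [h|[->|h]].
  - apply is_derive_ext_loc with (fun _ => 0).
    + apply (filter_imp (fun x => x < 0)); [|now apply open_lt].
      intros x hx. rewrite Rmax_left by lra. simpl. symmetry. apply Rmult_0_l.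
    + rewrite Rmax_left by lra. auto_derive; [easy|ring].
  - rewrite Rmax_left, Rmult_0_r by lra.
    apply is_derive_Reals. intros eps he. exists (mkposreal _ he).
    intros h h0 hh. simpl in hh. rewrite Rplus_0_l.
    rewrite (Rmax_left 0 0) by lra.
    unfold Rmax. destruct (Rle_dec 0 h).
    + replace ((h ^ 2 - 0 ^ 2) / h - 0) with h by (field; easy). easy.
    + replace ((0 ^ 2 - 0 ^ 2) / h - 0) with 0 by (field; easy). now rewrite Rabs_R0.
  - apply is_derive_ext_loc with (fun x => x ^ 2).
    + apply (filter_imp (fun x => 0 < x)); [|now apply open_gt].
      intros x hx. now rewrite Rmax_right by lra.
    + rewrite Rmax_right by lra. auto_derive; [easy|ring].
Qed.

Lemma is_derive_ramp (r : R) : is_derive ramp r (ramp' r).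
Proof.
  assert (h := pow2_ge_0 (Rmax 0 r)).
  evar_last.
  - apply (is_derive_comp (fun z => z / (1 + z)) (fun r => Rmax 0 r ^ 2)).
    + auto_derive; [lra|reflexivity].
    + apply is_derive_Rmax_0_sqr.
  - unfold ramp', scal; simpl. unfold mult; simpl. simpl in h. field. lra.
Qed.

Lemma continuity_pt_ramp (r : R) : continuity_pt ramp r.
Proof.
  apply derivable_continuous_pt. exists (ramp' r). apply is_derive_Reals, is_derive_ramp.
Qed.

Lemma continuity_pt_ramp' (r : R) : continuity_pt ramp' r.
Proof.
  assert (h := pow2_ge_0 (Rmax 0 r)).
  assert (hm : continuity_pt (Rmax 0) r).
  { apply continuity_pt_ext with (fun r => (r + Rabs r) * / 2).
    - intros z. unfold Rmax, Rabs. destruct (Rle_dec 0 z), (Rcase_abs z); lra.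
    - apply continuity_pt_mult; [apply continuity_pt_plus|].
      + apply continuity_pt_id.
      + apply Rcontinuity_abs.
      + now apply continuity_pt_const. }
  apply (continuity_pt_comp (Rmax 0) (fun z => 2 * z / (1 + z ^ 2) ^ 2)); [easy|].
  apply derivable_continuous_pt. apply ex_derive_Reals_0.
  auto_derive. nra.
Qed.

Lemma ramp_bounds (r : R) : 0 <= ramp r <= 1.
Proof.
  assert (h := pow2_ge_0 (Rmax 0 r)). unfold ramp. split.
  - apply Rle_div_r; lra.
  - apply Rle_div_l; lra.
Qed.

Lemma ramp_le_0 (r : R) : r <= 0 -> ramp r = 0.
Proof. intros h. unfold ramp. rewrite Rmax_left by lra. field. Qed.

Lemma ramp'_ge_0 (r : R) : 0 <= ramp' r.
Proof.
  assert (h := pow2_ge_0 (Rmax 0 r)). assert (h' := Rmax_l 0 r).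
  unfold ramp'. apply Rle_div_r; [nra|lra].
Qed.

Lemma ramp'_gt_0 (r : R) : 0 < r -> 0 < ramp' r.
Proof.
  intros hr. unfold ramp'. rewrite Rmax_right by lra.
  apply Rdiv_lt_0_compat; [lra|]. nra.
Qed.

(** * Integrals over the slices of a light cone *)

Definition continuous_for_pos_time (g : R -> R -> R) : Prop :=
  forall x t : R, 0 < t -> continuity_2d_pt g x t.

(** The boundary of the cone is included, so that no boundary terms appear when
    integrating over its slices. *)
Definition cone_supported (M : R) (g : R -> R -> R) : Prop :=
  forall x t : R, 0 < t -> M + t <= Rabs x -> g x t = 0.

Definition slice (M : R) (g : R -> R -> R) (t : R) : R :=
  RInt (fun x => g x t) (- (M + t)) (M + t).

Lemma continuous_comp_pos_time (F : R -> R) (g : R -> R -> R) :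
  (forall v, continuity_pt F v) -> continuous_for_pos_time g ->
  continuous_for_pos_time (fun x t => F (g x t)).
Proof. intros hF hg x t ht. apply continuity_1d_2d_pt_comp; [apply hF|now apply hg]. Qed.

Lemma continuity_2d_pt_swap (g : R -> R -> R) (x t : R) :
  continuity_2d_pt g x t -> continuity_2d_pt (fun s y => g y s) t x.
Proof. intros h eps. destruct (h eps) as [d hd]. exists d. intros; now apply hd. Qed.

Lemma continuity_2d_pt_continuous_1 (g : R -> R -> R) (x t : R) :
  continuity_2d_pt g x t -> continuous (fun y => g y t) x.
Proof.
  intros h. apply filterlim_locally. intros eps. destruct (h eps) as [d hd].
  exists d. intros y hy. apply (hd y t hy).
  rewrite Rminus_diag, Rabs_R0. apply cond_pos.
Qed.

Lemma ex_RInt_slice (g : R -> R -> R) (a b t : R) :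
  continuous_for_pos_time g -> 0 < t -> ex_RInt (fun x => g x t) a b.
Proof.
  intros h ht. apply (ex_RInt_continuous (V := R_CompleteNormedModule)).
  intros x _. now apply continuity_2d_pt_continuous_1, h.
Qed.

Lemma RInt_slice (M a b : R) (g : R -> R -> R) (t : R) :
  0 < M -> 0 < t -> continuous_for_pos_time g -> cone_supported M g ->
  a <= - (M + t) -> M + t <= b -> RInt (fun x => g x t) a b = slice M g t.
Proof.
  intros hM ht hc hs ha hb. unfold slice.
  assert (hI : forall a b, ex_RInt (fun x => g x t) a b)
    by (intros; now apply ex_RInt_slice).
  assert (hz : forall c d, c <= d -> d <= - (M + t) \/ M + t <= c ->
            RInt (fun x => g x t) c d = 0).
  { intros c d hcd hout. rewrite (RInt_ext _ (fun _ => 0)).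
    - rewrite RInt_const. apply Rmult_0_r.
    - intros x. rewrite Rmin_left, Rmax_right by easy. intros hx.
      apply hs; [easy|]. unfold Rabs; destruct (Rcase_abs x); lra. }
  rewrite <- (RInt_Chasles (V := R_CompleteNormedModule) _ a (- (M + t)) b)
    by easy.
  rewrite <- (RInt_Chasles (V := R_CompleteNormedModule) _ (- (M + t)) (M + t) b)
    by easy.
  rewrite (hz a), (hz (M + t)) by lra.
  change (0 + (RInt (fun x => g x t) (- (M + t)) (M + t) + 0)
          = RInt (fun x => g x t) (- (M + t)) (M + t)). ring.
Qed.

Lemma slice_plus (M : R) (g h : R -> R -> R) (t : R) : 0 < t ->
  continuous_for_pos_time g -> continuous_for_pos_time h ->
  slice M (fun x t => g x t + h x t) t = slice M g t + slice M h t.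
Proof.
  intros ht hg hh.
  apply (RInt_plus (V := R_CompleteNormedModule)); now apply ex_RInt_slice.
Qed.

Lemma slice_scal (M c : R) (g : R -> R -> R) (t : R) : 0 < t ->
  continuous_for_pos_time g ->
  slice M (fun x t => c * g x t) t = c * slice M g t.
Proof.
  intros ht hg.
  apply (RInt_scal (V := R_CompleteNormedModule)). now apply ex_RInt_slice.
Qed.

Lemma slice_le (M : R) (g h : R -> R -> R) (t : R) : 0 < M -> 0 < t ->
  continuous_for_pos_time g -> continuous_for_pos_time h ->
  (forall x, Rabs x <= M + t -> g x t <= h x t) -> slice M g t <= slice M h t.
Proof.
  intros hM ht hg hh hle. apply RInt_le; try (now apply ex_RInt_slice); [lra|].
  intros x hx. apply hle. apply Rabs_le; lra.
Qed.

Lemma slice_0 (M t : R) : slice M (fun _ _ => 0) t = 0.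
Proof. unfold slice. rewrite RInt_const. apply Rmult_0_r. Qed.

Lemma slice_ge_0 (M : R) (g : R -> R -> R) (t : R) : 0 < M -> 0 < t ->
  continuous_for_pos_time g ->
  (forall x, Rabs x <= M + t -> 0 <= g x t) -> 0 <= slice M g t.
Proof.
  intros hM ht hg hge. rewrite <- (slice_0 M t).
  apply slice_le; try easy. intros x s _. apply continuity_2d_pt_const.
Qed.

Lemma slice_gt_0 (M : R) (g : R -> R -> R) (t x0 : R) : 0 < M -> 0 < t ->
  continuous_for_pos_time g -> cone_supported M g ->
  (forall x, 0 <= g x t) -> 0 < g x0 t -> 0 < slice M g t.
Proof.
  intros hM ht hg hs hge hx0.
  assert (hx0M : Rabs x0 < M + t).
  { apply Rnot_le_lt. intros h. rewrite hs in hx0 by easy. lra. }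
  destruct (hg x0 t ht (mkposreal _ hx0)) as [d hd]. simpl in hd.
  assert (hd0 := cond_pos d).
  set (e := Rmin (d / 2) 1).
  assert (he1 : e <= d / 2) by apply Rmin_l.
  assert (he2 : e <= 1) by apply Rmin_r.
  assert (he : 0 < e) by (apply Rmin_pos; lra).
  apply Rabs_lt_between in hx0M.
  assert (hI : forall a b, ex_RInt (fun x => g x t) a b)
    by (intros; now apply ex_RInt_slice).
  rewrite <- (RInt_slice M (- (M + t + 1)) (M + t + 1)) by (easy || lra).
  rewrite <- (RInt_Chasles (V := R_CompleteNormedModule) _ _ (x0 - e) (M + t + 1))
    by easy.
  rewrite <- (RInt_Chasles (V := R_CompleteNormedModule) _ (x0 - e) (x0 + e) (M + t + 1))
    by easy.
  assert (h1 : 0 <= RInt (fun x => g x t) (- (M + t + 1)) (x0 - e)).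
  { apply RInt_ge_0; [lra|easy|easy]. }
  assert (h2 : 0 <= RInt (fun x => g x t) (x0 + e) (M + t + 1)).
  { apply RInt_ge_0; [lra|easy|easy]. }
  assert (h3 : 0 < RInt (fun x => g x t) (x0 - e) (x0 + e)).
  { apply RInt_gt_0; [lra| |].
    - intros x hx. assert (h : Rabs (g x t - g x0 t) < g x0 t).
      { apply hd; [apply Rabs_lt_between; lra|].
        rewrite Rminus_diag, Rabs_R0; easy. }
      apply Rabs_lt_between in h. lra.
    - intros x _. now apply continuity_2d_pt_continuous_1, hg. }
  unfold plus; simpl. lra.
Qed.

(** A local conservation law with source, g_t = j_x + k, integrates to a law for
    slices: the flux j is zero at both ends of a slice.  Near a given time the
    moving slice is replaced by a fixed larger interval, so that one may
    differentiate under the integral sign. *)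
Lemma is_derive_slice (M : R) (g j jx k : R -> R -> R) (t : R) :
  0 < M -> 0 < t ->
  continuous_for_pos_time g -> continuous_for_pos_time jx ->
  continuous_for_pos_time k ->
  cone_supported M g -> cone_supported M j -> cone_supported M k ->
  (forall x t, 0 < t -> is_derive (fun s => g x s) t (jx x t + k x t)) ->
  (forall x t, 0 < t -> is_derive (fun y => j y t) x (jx x t)) ->
  is_derive (slice M g) t (slice M k t).
Proof.
  intros hM ht cg cjx ck sg sj sk hg hj.
  (* One unit of room covers the slices of all nearby times. *)
  set (L := M + t + 1).
  assert (hnear : locally t (fun s => 0 < s /\ M + s <= L)).
  { exists (mkposreal _ (Rmin_pos _ _ ht Rlt_0_1)). intros s hs.
    change (Rabs (s - t) < Rmin t 1) in hs. apply Rabs_lt_between in hs.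
    assert (h1 := Rmin_l t 1). assert (h2 := Rmin_r t 1). unfold L. lra. }
  apply is_derive_ext_loc with (fun s => RInt (fun x => g x s) (- L) L).
  { revert hnear. apply filter_imp. intros s [hs hsL].
    apply RInt_slice; easy || lra. }
  evar_last.
  - apply (is_derive_RInt_param (fun s x => g x s)).
    + revert hnear. apply filter_imp. intros s [hs _] x _.
      exists (jx x s + k x s). now apply hg.
    + intros x _.
      apply continuity_2d_pt_ext_loc with (fun s y => jx y s + k y s).
      * exists (mkposreal _ ht). intros s y hs _. symmetry.
        apply is_derive_unique, hg. apply Rabs_lt_between in hs. simpl in hs. lra.
      * apply (continuity_2d_pt_swap (fun y s => jx y s + k y s)).
        apply continuity_2d_pt_plus; [now apply cjx|now apply ck].
    + revert hnear. apply filter_imp. intros s [hs _]. now apply ex_RInt_slice.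
  - rewrite (RInt_ext _ (fun x => jx x t + k x t)).
    2: { intros x _. now apply is_derive_unique, hg. }
    assert (hjx : is_RInt (fun x => jx x t) (- L) L 0).
    { evar_last.
      - apply (is_RInt_derive (V := R_CompleteNormedModule) (fun x => j x t)).
        + intros x _. now apply hj.
        + intros x _. now apply continuity_2d_pt_continuous_1, cjx.
      - rewrite !sj; try easy.
        + apply Rminus_diag.
        + rewrite Rabs_Ropp. eapply Rle_trans; [|apply Rle_abs]. unfold L; lra.
        + eapply Rle_trans; [|apply Rle_abs]. unfold L; lra. }
    rewrite <- (RInt_slice M (- L) L k) by (easy || unfold L; lra).
    apply (is_RInt_unique (V := R_CompleteNormedModule)).
    evar_last.
    + apply (is_RInt_plus (V := R_NormedModule)); [exact hjx|].
      apply (RInt_correct (V := R_CompleteNormedModule)). now apply ex_RInt_slice.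
    + apply Rplus_0_l.
Qed.

(** * Waves and their characteristic derivatives *)

(** The two mixed second derivatives agree; both are recorded as [dx (dt u)]. *)
Record global_wave (p : R) (u : R -> R -> R) : Prop := {
  wave_cont : continuous_for_pos_time u;
  wave_cont_x : continuous_for_pos_time (dx u);
  wave_cont_t : continuous_for_pos_time (dt u);
  wave_cont_xx : continuous_for_pos_time (dx (dx u));
  wave_cont_xt : continuous_for_pos_time (dx (dt u));
  wave_dx : forall x t, 0 < t -> is_derive (fun y => u y t) x (dx u x t);
  wave_dt : forall x t, 0 < t -> is_derive (fun s => u x s) t (dt u x t);
  wave_dxx : forall x t, 0 < t ->
    is_derive (fun y => dx u y t) x (dx (dx u) x t);
  wave_dtx : forall x t, 0 < t ->
    is_derive (fun s => dx u x s) t (dx (dt u) x t);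
  wave_dxt : forall x t, 0 < t ->
    is_derive (fun y => dt u y t) x (dx (dt u) x t);
  wave_dtt : forall x t, 0 < t ->
    is_derive (fun s => dt u x s) t (dt (dt u) x t);
  wave_eq : forall x t, 0 < t ->
    dt (dt u) x t = dx (dx u) x t + nonlinearity p (u x t)
}.

Lemma solution_global_wave (p : R) (u0 u1 : R -> R) (u : R -> R -> R) :
  is_solution p u0 u1 p_infty u -> global_wave p u.
Proof.
  intros hu.
  assert (h : forall x t, 0 < t -> ex_diff_n u 2 x t)
    by (intros; now apply (solution_C2 _ _ _ _ _ hu)).
  assert (hcm : forall x t, 0 < t -> dt (dx u) x t = dx (dt u) x t).
  { intros x t ht. symmetry. apply (Schwarz u).
    - exists (mkposreal _ ht). intros y s _ hs.
      apply Rabs_lt_between in hs; simpl in hs.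
      destruct (h y s) as (_ & a & b & (_ & _ & c & _) & (_ & d & _)); [lra|].
      now repeat split.
    - now destruct (h x t ht) as (_ & _ & _ & _ & (_ & _ & _ & (c & _) & _)).
    - now destruct (h x t ht) as (_ & _ & _ & (_ & _ & _ & _ & (c & _)) & _). }
  split; intros x t ht; try (rewrite <- (hcm x t ht));
    destruct (h x t ht) as (c0 & ex & et & (cx & exx & etx & (cxx & _) & (ctx & _))
                        & (ct & ext & ett & (cxt & _) & (ctt & _)));
    try easy; try now apply Derive_correct.
  - rewrite hcm by easy. now apply Derive_correct.
  - assert (e := solution_eq _ _ _ _ _ hu x t ht I). lra.
Qed.

(** For s = 1 and s = -1 these are the derivatives along the two families of
    characteristics.  Keeping s as a parameter with s^2 = 1 treats
    the two mirror images at once. *)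
Definition char_deriv (s : R) (u : R -> R -> R) (x t : R) : R :=
  dt u x t + s * dx u x t.

Lemma is_derive_char_deriv_x (p s x t : R) (u : R -> R -> R) :
  global_wave p u -> 0 < t ->
  is_derive (fun y => char_deriv s u y t) x
    (dx (dt u) x t + s * dx (dx u) x t).
Proof.
  intros hu ht. apply (is_derive_plus (V := R_NormedModule)).
  - now apply (wave_dxt p).
  - apply (is_derive_scal (fun y => dx u y t)). now apply (wave_dxx p).
Qed.

Lemma is_derive_char_deriv_t (p s x t : R) (u : R -> R -> R) :
  global_wave p u -> 0 < t ->
  is_derive (fun r => char_deriv s u x r) t
    (dt (dt u) x t + s * dx (dt u) x t).
Proof.
  intros hu ht. apply (is_derive_plus (V := R_NormedModule)).
  - now apply (wave_dtt p).
  - apply (is_derive_scal (fun r => dx u x r)). now apply (wave_dtx p).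
Qed.

Lemma continuous_char_derivatives_x (p s : R) (u : R -> R -> R) :
  global_wave p u ->
  continuous_for_pos_time (fun x t => dx (dt u) x t + s * dx (dx u) x t).
Proof.
  intros hu x t ht. apply continuity_2d_pt_plus.
  - now apply (wave_cont_xt p).
  - apply continuity_2d_pt_mult; [apply continuity_2d_pt_const|].
    now apply (wave_cont_xx p).
Qed.

(** * Finite speed of propagation *)

Lemma is_derive_along (g gx gt : R -> R -> R) (c k t : R) : 0 < t ->
  continuous_for_pos_time gx ->
  (forall x t, 0 < t -> is_derive (fun y => g y t) x (gx x t)) ->
  (forall x t, 0 < t -> is_derive (fun s => g x s) t (gt x t)) ->
  is_derive (fun s => g (c + k * s) s) t
    (k * gx (c + k * t) t + gt (c + k * t) t).
Proof.
  intros ht cgx hx hgt. apply is_derive_Reals.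
  replace (k * gx (c + k * t) t + gt (c + k * t) t)
    with (gx (c + k * t) t * k + gt (c + k * t) t * 1) by ring.
  apply (derivable_pt_lim_comp_2d g (fun s => c + k * s) (fun s => s)).
  - apply filterdiff_differentiable_pt_lim.
    apply (is_derive_filterdiff g (c + k * t) t gx).
    + apply (locally_2d_locally
        (fun y s => is_derive (fun z => g z s) y (gx y s))).
      exists (mkposreal _ ht). intros y s _ hs.
      apply hx. apply Rabs_lt_between in hs; simpl in hs. lra.
    + now apply hgt.
    + apply (continuity_2d_pt_filterlim gx). now apply cgx.
  - apply is_derive_Reals. auto_derive; [easy|ring].
  - apply is_derive_Reals. apply (is_derive_id (t : R_AbsRing)).
Qed.

Lemma exp_growth_bound_one_sided (h dh : R -> R) (K l t : R) : 0 < l -> 0 < t ->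
  (forall s, 0 < s <= t -> is_derive h s (dh s)) ->
  (forall s, 0 < s <= t -> Rabs (dh s) <= K * exp (l * s)) ->
  (forall eps, 0 < eps ->
     exists d, 0 < d /\ forall s, 0 < s < d -> Rabs (h s) < eps) ->
  h t <= K / l * exp (l * t).
Proof.
  intros hl ht hd hb h0.
  apply Rle_plus_epsilon. intros eps heps.
  destruct (h0 eps heps) as [d [hd0 hsmall]].
  set (s := Rmin (d / 2) t).
  assert (hs1 : s <= d / 2) by apply Rmin_l.
  assert (hs2 : s <= t) by apply Rmin_r.
  assert (hs : 0 < s) by (apply Rmin_pos; lra).
  assert (hm : K / l * exp (l * s) - h s <= K / l * exp (l * t) - h t).
  { apply (derivative_ge_0_le (fun r => K / l * exp (l * r) - h r)
             (fun r => K * exp (l * r) - dh r)); [easy| |].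
    - intros r hr.
      apply (is_derive_minus (V := R_NormedModule) (fun r => K / l * exp (l * r))).
      + auto_derive; [easy|field; lra].
      + apply hd; lra.
    - intros r hr. assert (hbr := hb r). assert (habs := Rle_abs (dh r)). lra. }
  assert (hK : 0 <= K / l * exp (l * s)).
  { assert (hKs := Rle_trans _ _ _ (Rabs_pos _) (hb s (conj hs hs2))).
    unfold Rdiv. rewrite Rmult_assoc, (Rmult_comm (/ l)), <- Rmult_assoc.
    apply Rmult_le_pos; [easy|]. apply Rlt_le, Rinv_0_lt_compat; lra. }
  assert (h1 := hsmall s). assert (h2 := Rle_abs (h s)). lra.
Qed.

(** Comparison with the solution of the equation h' = K exp(l t): integrating an
    exponential gains the factor 1 / l. *)
Lemma exp_growth_bound (h dh : R -> R) (K l t : R) : 0 < l -> 0 < t ->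
  (forall s, 0 < s <= t -> is_derive h s (dh s)) ->
  (forall s, 0 < s <= t -> Rabs (dh s) <= K * exp (l * s)) ->
  (forall eps, 0 < eps ->
     exists d, 0 < d /\ forall s, 0 < s < d -> Rabs (h s) < eps) ->
  Rabs (h t) <= K / l * exp (l * t).
Proof.
  intros hl ht hd hb h0. apply Rabs_le. split.
  - apply Ropp_le_cancel. rewrite Ropp_involutive.
    apply (exp_growth_bound_one_sided (fun s => - h s) (fun s => - dh s)); try easy.
    + intros s hs. apply (is_derive_opp (V := R_NormedModule)). now apply hd.
    + intros s hs. rewrite Rabs_Ropp. now apply hb.
    + intros eps heps. destruct (h0 eps heps) as [d [hd0 hs]].
      exists d. split; [easy|]. intros s. rewrite Rabs_Ropp. apply hs.
  - now apply (exp_growth_bound_one_sided h dh).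
Qed.

Lemma initial_limit_along (w : R -> R -> R) (c k l : R) : Rabs k <= 1 ->
  initial_limit w c l -> forall eps, 0 < eps ->
  exists d, 0 < d /\ forall s, 0 < s < d -> Rabs (w (c + k * s) s - l) < eps.
Proof.
  intros hk hw eps heps.
  assert (h := proj1 (filterlim_locally _ _) hw (mkposreal _ heps)).
  unfold within in h.
  apply (locally_2d_locally (fun y s => 0 < s -> ball l eps (w y s))) in h.
  destruct h as [d hd]. exists d. split; [apply cond_pos|]. intros s hs.
  apply hd; [| |easy].
  - replace (c + k * s - c) with (k * s) by ring. rewrite Rabs_mult.
    rewrite (Rabs_pos_eq s) by lra. nra.
  - rewrite Rminus_0_r, Rabs_pos_eq; lra.
Qed.

(** The wave operator factors as the product of the two characteristic
    derivatives, so u_t + s u_x satisfies an ordinary differential equation with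
    right-hand side f(u) along the lines of velocity - s. *)
Lemma is_derive_char_deriv_along (p s c t : R) (u : R -> R -> R) :
  global_wave p u -> s * s = 1 -> 0 < t ->
  is_derive (fun r => char_deriv s u (c + - s * r) r) t
    (nonlinearity p (u (c + - s * t) t)).
Proof.
  intros hu hs ht. evar_last.
  - apply (is_derive_along (char_deriv s u) _
      (fun x t => dt (dt u) x t + s * dx (dt u) x t) c (- s) t ht
      (continuous_char_derivatives_x p s u hu)).
    + intros; now apply (is_derive_char_deriv_x p).
    + intros; now apply (is_derive_char_deriv_t p).
  - simpl. rewrite (wave_eq p) by easy.
    set (A := dx (dt u) _ _). set (B := dx (dx u) _ _).
    replace (- s * (A + s * B)) with (- (s * A) - (s * s) * B) by ring.
    rewrite hs. ring.
Qed.

(** The cone is not closed at t = 0, where u is only known through its limits.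
    Since these are 0, the extension of u by 0 to t <= 0 is continuous on a
    compact rectangle that contains the cone. *)
Lemma bounded_on_backward_cone (u : R -> R -> R) (M x0 t0 : R) :
  continuous_for_pos_time u -> (forall x, M < Rabs x -> initial_limit u x 0) ->
  0 < t0 -> M + t0 < Rabs x0 ->
  exists B, forall x t, 0 < t -> Rabs (x - x0) <= t0 - t -> Rabs (u x t) <= B.
Proof.
  intros hc hl ht0 hx0.
  destruct (continuity_2d_pt_bounded (fun x t => if Rle_dec t 0 then 0 else u x t)
    (x0 - t0) (x0 + t0) 0 t0) as [B hB].
  - intros x t hx ht. destruct (Rle_lt_or_eq_dec 0 t (proj1 ht)) as [h|<-].
    + apply continuity_2d_pt_ext_loc with u; [|now apply hc].
      exists (mkposreal _ h). intros y s _ hs. apply Rabs_lt_between in hs.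
      simpl in hs. destruct (Rle_dec s 0); [lra|easy].
    + assert (hxM : M < Rabs x).
      { assert (h := Rabs_triang_inv x0 x).
        assert (Rabs (x0 - x) <= t0) by (apply Rabs_le; lra). lra. }
      intros eps.
      assert (h := proj1 (filterlim_locally _ _) (hl x hxM) eps).
      unfold within in h.
      apply (locally_2d_locally (fun y s => 0 < s -> ball 0 eps (u y s))) in h.
      destruct h as [d hd]. exists d. intros y s hy hs.
      destruct (Rle_dec 0 0) as [_|n]; [|now destruct n; right].
      destruct (Rle_dec s 0) as [_|n].
      * rewrite Rminus_diag, Rabs_R0. apply cond_pos.
      * apply hd; try easy. lra.
  - exists B. intros x t ht hx.
    apply Rabs_le_between in hx.
    assert (h := hB x t). destruct (Rle_dec t 0); [lra|]. apply h; lra.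
Qed.

(** On the backward cone of a point outside the influence of the data, u is
    bounded, hence |f(u)| <= C |u|.  If |u| <= A exp(l t) on the cone, then
    integrating along characteristics bounds u_t + u_x and u_t - u_x, thus u_t,
    by (C A / l) exp(l t), and integrating in time bounds u by
    (C A / l^2) exp(l t).  For l large this halves A, and iterating gives u = 0. *)
Lemma finite_speed (p M : R) (u0 u1 : R -> R) (u : R -> R -> R) :
  1 < p -> is_solution p u0 u1 p_infty u ->
  (forall x, M < Rabs x -> u0 x = 0) -> (forall x, M < Rabs x -> u1 x = 0) ->
  forall x t, 0 < t -> M + t < Rabs x -> u x t = 0.
Proof.
  intros hp hsol h0 h1 x0 t0 ht0 hx0.
  assert (hu := solution_global_wave p u0 u1 u hsol).
  assert (lu : forall x, M < Rabs x -> initial_limit u x 0).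
  { intros x hx. rewrite <- (h0 x hx). apply (solution_u_lim _ _ _ _ _ hsol). }
  assert (lut : forall x, M < Rabs x -> initial_limit (dt u) x 0).
  { intros x hx. rewrite <- (h1 x hx). apply (solution_ut_lim _ _ _ _ _ hsol). }
  assert (lux : forall x, M < Rabs x -> initial_limit (dx u) x 0).
  { intros x hx. replace 0 with (Derive u0 x).
    - apply (solution_ux_lim _ _ _ _ _ hsol).
    - rewrite <- (Derive_const 0 x). apply Derive_ext_loc.
      assert (hd : 0 < Rabs x - M) by lra.
      exists (mkposreal _ hd). intros y hy. apply h0.
      change (Rabs (y - x) < Rabs x - M) in hy.
      assert (h := Rabs_triang_inv x y). rewrite Rabs_minus_sym in hy. lra. }
  destruct (bounded_on_backward_cone u M x0 t0) as [B hB]; try easy.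
  { apply (wave_cont p _ hu). }
  set (K x t := 0 < t /\ Rabs (x - x0) <= t0 - t).
  (* The characteristics through points of the cone start where the data vanish. *)
  assert (KM : forall x t k, Rabs k <= 1 -> K x t -> M < Rabs (x + k * t)).
  { intros x t k hk [ht hx]. assert (h := Rabs_triang_inv x0 (x + k * t)).
    assert (h' := Rabs_triang (x0 - x) (- (k * t))).
    replace (x0 - x + - (k * t)) with (x0 - (x + k * t)) in h' by ring.
    rewrite Rabs_Ropp, Rabs_mult, (Rabs_pos_eq t), (Rabs_minus_sym x0 x) in h' by lra.
    nra. }
  assert (Kpath : forall x t k s, Rabs k <= 1 -> K x t -> 0 < s <= t ->
     K (x + k * t + - k * s) s).
  { intros x t k s hk [ht hx] hs. split; [easy|].
    assert (h := Rabs_triang (x - x0) (k * (t - s))).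
    replace (x - x0 + k * (t - s)) with (x + k * t + - k * s - x0) in h by ring.
    rewrite Rabs_mult, (Rabs_pos_eq (t - s)) in h by lra. nra. }
  set (C := Rpower (B) (p - 1)).
  assert (hC : 0 < C) by apply Rpower_gt_0.
  (* Then C / l <= 1/2 and l >= 1, so each round of the iteration halves the bound. *)
  set (l := 1 + 2 * C).
  assert (hl : 0 < l) by (unfold l; lra).
  assert (step : forall A, (forall x t, K x t -> Rabs (u x t) <= A * exp (l * t)) ->
     forall x t, K x t -> Rabs (u x t) <= A / 2 * exp (l * t)).
  { intros A hA.
    assert (A0 : forall x t, K x t -> 0 <= A).
    { intros x t hK. assert (h := Rle_trans _ _ _ (Rabs_pos _) (hA x t hK)).
      assert (he := exp_pos (l * t)). nra. }
    assert (hchar : forall s x t, s * s = 1 -> K x t ->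
              Rabs (char_deriv s u x t) <= A / 2 * exp (l * t)).
    { intros s x t hs hK.
      assert (hs1 : Rabs s <= 1).
      { assert (h : Rabs s * Rabs s = 1) by (now rewrite <- Rabs_mult, hs, Rabs_R1).
        assert (h' := Rabs_pos s). nra. }
      assert (hns1 : Rabs (- s) <= 1) by now rewrite Rabs_Ropp.
      assert (e : x = (x + s * t) + - s * t) by ring.
      rewrite e at 1.
      apply Rle_trans with ((C * A) / l * exp (l * t)).
      - apply (exp_growth_bound (fun r => char_deriv s u (x + s * t + - s * r) r)
          (fun r => nonlinearity p (u (x + s * t + - s * r) r))); try easy.
        + apply hK.
        + intros r hr. now apply is_derive_char_deriv_along.
        + intros r hr. assert (hKr := Kpath x t s r hs1 hK hr).
          eapply Rle_trans.
          { apply (Rabs_nonlinearity_le p B); [easy|]. apply hB; apply hKr. }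
          rewrite Rmult_assoc. apply Rmult_le_compat_l; [now apply Rlt_le|].
          now apply hA.
        + intros eps heps.
          assert (hM := KM x t s hs1 hK).
          assert (heps2 : 0 < eps / 2) by lra.
          destruct (initial_limit_along _ _ (- s) _ hns1 (lut _ hM) _ heps2)
            as (d1 & hd1 & hr1).
          destruct (initial_limit_along _ _ (- s) _ hns1 (lux _ hM) _ heps2)
            as (d2 & hd2 & hr2).
          exists (Rmin d1 d2). split; [now apply Rmin_pos|].
          intros r hr. assert (m1 := Rmin_l d1 d2). assert (m2 := Rmin_r d1 d2).
          assert (hr1' := hr1 r). assert (hr2' := hr2 r).
          rewrite Rminus_0_r in hr1', hr2'.
          unfold char_deriv. eapply Rle_lt_trans; [apply Rabs_triang|].
          rewrite Rabs_mult.
          assert (hx0' := Rabs_pos (dx u (x + s * t + - s * r) r)). nra.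
      - apply Rmult_le_compat_r; [apply Rlt_le, exp_pos|].
        assert (hA0 := A0 x t hK).
        apply Rle_div_l; [easy|]. unfold l. nra. }
    assert (hut : forall x t, K x t -> Rabs (dt u x t) <= A / 2 * exp (l * t)).
    { intros x t hK.
      assert (hp1 := hchar 1 x t ltac:(ring) hK).
      assert (hm1 := hchar (-1) x t ltac:(ring) hK).
      unfold char_deriv in hp1, hm1.
      apply Rabs_le_between in hp1. apply Rabs_le_between in hm1.
      apply Rabs_le. lra. }
    intros x t hK.
    assert (R0 : Rabs 0 <= 1) by (rewrite Rabs_R0; lra).
    apply Rle_trans with ((A / 2) / l * exp (l * t)).
    - apply (exp_growth_bound (fun r => u x r) (dt u x)); try easy.
      + apply hK.
      + intros r hr. now apply (wave_dt p).
      + intros r hr. apply hut.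
        replace x with (x + 0 * t + - 0 * r) by ring. now apply Kpath.
      + intros eps heps.
        assert (hM := KM x t 0 R0 hK). rewrite Rmult_0_l, Rplus_0_r in hM.
        destruct (initial_limit_along _ _ 0 _ R0 (lu _ hM) _ heps) as (d & hd & hr).
        exists d. split; [easy|]. intros r hr'. assert (h := hr r hr').
        now rewrite Rmult_0_l, Rplus_0_r, Rminus_0_r in h.
    - apply Rmult_le_compat_r; [apply Rlt_le, exp_pos|].
      assert (hA0 := A0 x t hK).
      apply Rle_div_l; [easy|]. unfold l. nra. }
  assert (iter : forall n x t, K x t -> Rabs (u x t) <= B / 2 ^ n * exp (l * t)).
  { induction n as [|n IH].
    - intros x t hK. simpl. rewrite Rdiv_1_r.
      assert (h := hB x t (proj1 hK) (proj2 hK)).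
      assert (h' := exp_ineq1_le (l * t)).
      assert (0 <= l * t) by (apply Rmult_le_pos; [lra|apply Rlt_le, hK]).
      assert (h'' := Rabs_pos (u x t)). nra.
    - intros x t hK. replace (B / 2 ^ S n) with (B / 2 ^ n / 2).
      + now apply step.
      + simpl. field. apply pow_nonzero. lra. }
  assert (hK0 : K x0 t0).
  { split; [easy|]. rewrite Rminus_diag, Rabs_R0. lra. }
  assert (hlim : is_lim_seq (fun n => B / 2 ^ n * exp (l * t0)) 0).
  { apply is_lim_seq_ext with (fun n => (B * exp (l * t0)) * (/ 2) ^ n).
    - intros n. rewrite pow_inv. unfold Rdiv. ring.
    - evar_last.
      + apply is_lim_seq_scal_l, is_lim_seq_geom. rewrite Rabs_pos_eq; lra.
      + simpl. f_equal. ring. }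
  assert (hle := is_lim_seq_le _ _ (Rabs (u x0 t0)) 0
     (fun n => iter n x0 t0 hK0) (is_lim_seq_const _) hlim).
  simpl in hle. apply Rabs_eq_0. assert (h := Rabs_pos (u x0 t0)). lra.
Qed.

(** The derivatives are included so that every density built from them vanishes at
    the ends of a slice. *)
Record cone_wave (p M : R) (u : R -> R -> R) : Prop := {
  cone_wave_p : 1 < p;
  cone_wave_M : 0 < M;
  cone_wave_wave : global_wave p u;
  cone_wave_u : cone_supported M u;
  cone_wave_ux : cone_supported M (dx u);
  cone_wave_ut : cone_supported M (dt u)
}.

(** One unit of room beyond the support of the data makes u vanish near every point
    of the cone's boundary, so that its derivatives vanish there too. *)
Lemma solution_cone_wave (p M : R) (u0 u1 : R -> R) (u : R -> R -> R) :
  1 < p -> 0 <= M -> is_solution p u0 u1 p_infty u ->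
  (forall x, M < Rabs x -> u0 x = 0) -> (forall x, M < Rabs x -> u1 x = 0) ->
  cone_wave p (M + 1) u.
Proof.
  intros hp hM hsol h0 h1.
  assert (hz := finite_speed p M u0 u1 u hp hsol h0 h1).
  assert (far : forall x t y s, M + 1 + t <= Rabs x ->
            Rabs (y - x) < / 2 -> Rabs (s - t) < / 2 -> M + s < Rabs y).
  { intros x t y s hx hy hs. assert (h := Rabs_triang_inv x y).
    rewrite Rabs_minus_sym in hy. apply Rabs_lt_between in hs. lra. }
  assert (half : forall z, Rabs (z - z) < / 2).
  { intros z. rewrite Rminus_diag, Rabs_R0. lra. }
  split; try easy.
  - lra.
  - now apply (solution_global_wave p u0 u1).
  - intros x t ht hx. apply hz; lra.
  - intros x t ht hx. unfold dx. rewrite <- (Derive_const 0 x).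
    apply Derive_ext_loc.
    assert (hd : 0 < / 2) by lra. exists (mkposreal _ hd). intros y hy.
    apply hz; [easy|]. now apply (far x t y t).
  - intros x t ht hx. unfold dt. rewrite <- (Derive_const 0 t).
    apply Derive_ext_loc.
    assert (hd : 0 < Rmin t (/ 2)) by (apply Rmin_pos; lra).
    exists (mkposreal _ hd). intros s hs.
    change (Rabs (s - t) < Rmin t (/ 2)) in hs.
    assert (m1 := Rmin_l t (/ 2)). assert (m2 := Rmin_r t (/ 2)).
    apply hz.
    + apply Rabs_lt_between in hs. lra.
    + apply (far x t x s); [easy|easy|lra].
Qed.

(** * Local conservation laws *)

Definition kinetic (u : R -> R -> R) (x t : R) : R :=
  (dt u x t ^ 2 + dx u x t ^ 2) / 2.
Definition potential_density (p : R) (u : R -> R -> R) (x t : R) : R :=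
  potential p (u x t).
Definition energy (p : R) (u : R -> R -> R) (x t : R) : R :=
  kinetic u x t - potential_density p u x t.
Definition momentum (u : R -> R -> R) (x t : R) : R := dt u x t * dx u x t.
(** The flux of momentum; the sign in front of the potential is opposite to that of
    [energy]. *)
Definition pressure (p : R) (u : R -> R -> R) (x t : R) : R :=
  kinetic u x t + potential_density p u x t.

Section ConeWaves.
Context (p M : R) (u : R -> R -> R) (hu : cone_wave p M u).

Let hp := cone_wave_p p M u hu.
Let hM := cone_wave_M p M u hu.
Let hw := cone_wave_wave p M u hu.

Lemma continuous_potential_density : continuous_for_pos_time (potential_density p u).
Proof.
  apply (continuous_comp_pos_time (potential p)).
  - intros v. now apply continuity_pt_potential.
  - apply (wave_cont p u hw).
Qed.

Lemma continuous_kinetic : continuous_for_pos_time (kinetic u).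
Proof.
  intros x t ht.
  assert (h1 := wave_cont_x p u hw x t ht). assert (h2 := wave_cont_t p u hw x t ht).
  unfold kinetic. continuity_2d.
Qed.

Lemma supported_potential_density : cone_supported M (potential_density p u).
Proof.
  intros x t ht hx. unfold potential_density.
  rewrite (cone_wave_u _ _ _ hu) by easy. apply potential_0.
Qed.

Lemma supported_kinetic : cone_supported M (kinetic u).
Proof.
  intros x t ht hx. unfold kinetic.
  rewrite (cone_wave_ux _ _ _ hu), (cone_wave_ut _ _ _ hu) by easy. lra.
Qed.

Lemma potential_density_ge_0 (x t : R) : 0 <= potential_density p u x t.
Proof. now apply potential_ge_0. Qed.

Lemma is_derive_kinetic (a b : R -> R) (a' b' r : R) :
  is_derive a r a' -> is_derive b r b' ->
  is_derive (fun r => (a r ^ 2 + b r ^ 2) / 2) r (a r * a' + b r * b').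
Proof.
  intros ha hb.
  assert (h : forall c c', is_derive c r c' -> is_derive (fun r => c r ^ 2) r (2 * c r * c')).
  { intros c c' hc. evar_last; [apply (is_derive_pow c 2 r c'); exact hc|simpl; ring]. }
  evar_last.
  - apply (is_derive_ext (fun r => / 2 * (a r ^ 2 + b r ^ 2))).
    + intros x. apply Rmult_comm.
    + apply (is_derive_scal (fun r => a r ^ 2 + b r ^ 2)).
      apply (is_derive_plus (V := R_NormedModule)); apply h; eassumption.
  - unfold plus; simpl. field.
Qed.

Lemma is_derive_potential_comp (w : R -> R) (w' r : R) : is_derive w r w' ->
  is_derive (fun r => potential p (w r)) r (nonlinearity p (w r) * w').
Proof.
  intros h. rewrite Rmult_comm.
  apply (is_derive_comp (potential p) w); [now apply is_derive_potential|easy].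
Qed.

Lemma is_derive_kinetic_t (x t : R) : 0 < t ->
  is_derive (fun r => kinetic u x r) t
    (dt u x t * (dx (dx u) x t + nonlinearity p (u x t)) + dx u x t * dx (dt u) x t).
Proof.
  intros ht. rewrite <- (wave_eq p u hw) by easy. apply is_derive_kinetic.
  - now apply (wave_dtt p u hw).
  - now apply (wave_dtx p u hw).
Qed.

Lemma is_derive_kinetic_x (x t : R) : 0 < t ->
  is_derive (fun y => kinetic u y t) x
    (dt u x t * dx (dt u) x t + dx u x t * dx (dx u) x t).
Proof.
  intros ht.
  apply (is_derive_kinetic (fun y => dt u y t) (fun y => dx u y t)).
  - now apply (wave_dxt p u hw).
  - now apply (wave_dxx p u hw).
Qed.

Lemma is_derive_potential_t (x t : R) : 0 < t ->
  is_derive (fun r => potential_density p u x r) t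
    (nonlinearity p (u x t) * dt u x t).
Proof.
  intros ht. apply (is_derive_potential_comp (u x)). now apply (wave_dt p u hw).
Qed.

Lemma is_derive_potential_x (x t : R) : 0 < t ->
  is_derive (fun y => potential_density p u y t) x
    (nonlinearity p (u x t) * dx u x t).
Proof.
  intros ht. apply (is_derive_potential_comp (fun y => u y t)).
  now apply (wave_dx p u hw).
Qed.

Lemma is_derive_momentum_x (x t : R) : 0 < t ->
  is_derive (fun y => momentum u y t) x
    (dx (dt u) x t * dx u x t + dt u x t * dx (dx u) x t).
Proof.
  intros ht. apply (is_derive_mult (fun y => dt u y t) (fun y => dx u y t)).
  - now apply (wave_dxt p u hw).
  - now apply (wave_dxx p u hw).
  - intros; apply Rmult_comm.
Qed.

Lemma is_derive_energy_t (x t : R) : 0 < t ->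
  is_derive (fun r => energy p u x r) t
    (dx (dt u) x t * dx u x t + dt u x t * dx (dx u) x t).
Proof.
  intros ht. evar_last.
  - apply (is_derive_minus (V := R_NormedModule)).
    + now apply is_derive_kinetic_t.
    + now apply is_derive_potential_t.
  - unfold minus, plus, opp; simpl. ring.
Qed.

Definition pressure_x (x t : R) : R :=
  dt u x t * dx (dt u) x t + dx u x t * dx (dx u) x t
  + nonlinearity p (u x t) * dx u x t.

Lemma is_derive_pressure_x (x t : R) : 0 < t ->
  is_derive (fun y => pressure p u y t) x (pressure_x x t).
Proof.
  intros ht. apply (is_derive_plus (V := R_NormedModule)).
  - now apply is_derive_kinetic_x.
  - now apply is_derive_potential_x.
Qed.

Lemma is_derive_momentum_t (x t : R) : 0 < t ->
  is_derive (fun r => momentum u x r) t (pressure_x x t).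
Proof.
  intros ht. evar_last.
  - apply (is_derive_mult (fun r => dt u x r) (fun r => dx u x r)).
    + now apply (wave_dtt p u hw).
    + now apply (wave_dtx p u hw).
    + intros; apply Rmult_comm.
  - rewrite (wave_eq p u hw) by easy. unfold pressure_x, plus, mult; simpl. ring.
Qed.

Lemma continuous_nonlinearity_wave :
  continuous_for_pos_time (fun x t => nonlinearity p (u x t)).
Proof.
  apply continuous_comp_pos_time.
  - intros v. now apply continuity_pt_nonlinearity.
  - apply (wave_cont p u hw).
Qed.

Ltac wave_continuity_at y r hr :=
  assert (c0 := wave_cont p u hw y r hr);
  assert (c1 := wave_cont_x p u hw y r hr);
  assert (c2 := wave_cont_t p u hw y r hr);
  assert (c3 := wave_cont_xx p u hw y r hr);
  assert (c4 := wave_cont_xt p u hw y r hr);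
  assert (c6 := continuous_nonlinearity_wave y r hr);
  assert (c7 := continuous_potential_density y r hr);
  assert (c8 := continuous_kinetic y r hr);
  unfold energy, pressure, momentum, pressure_x, char_deriv;
  continuity_2d.

Ltac wave_continuity :=
  let y := fresh "y" in let r := fresh "r" in let hr := fresh "hr" in
  intros y r hr; wave_continuity_at y r hr.

Lemma energy_conserved (t : R) : 0 < t -> slice M (energy p u) t = slice M (energy p u) 1.
Proof.
  intros ht.
  assert (h : forall r, 0 < r -> is_derive (slice M (energy p u)) r 0).
  { intros r hr. rewrite <- (slice_0 M r).
    apply (is_derive_slice M (energy p u) (momentum u)
      (fun x t => dx (dt u) x t * dx u x t + dt u x t * dx (dx u) x t)); try easy.
    - wave_continuity.
    - wave_continuity.
    - wave_continuity.
    - intros x s hs hx. unfold energy.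
      rewrite supported_kinetic, supported_potential_density by easy. lra.
    - intros x s hs hx. unfold momentum.
      rewrite (cone_wave_ux _ _ _ hu) by easy. ring.
    - intros x s hs. rewrite Rplus_0_r. now apply is_derive_energy_t.
    - intros x s hs. now apply is_derive_momentum_x. }
  destruct (MVT_gen (slice M (energy p u)) 1 t (fun _ => 0)) as [c [_ hc]].
  - intros r hr. apply h. assert (hm := Rmin_pos _ _ Rlt_0_1 ht). lra.
  - intros r hr. apply derivable_continuous_pt. exists 0. apply is_derive_Reals, h.
    assert (hm := Rmin_pos _ _ Rlt_0_1 ht). lra.
  - lra.
Qed.

(** Its kinetic part is
    ((M + t + x) (u_t + u_x)^2 + (M + t - x) (u_t - u_x)^2) / 4, which is
    nonnegative inside the cone. *)
Definition conformal_density (x t : R) : R :=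
  (M + t) * energy p u x t + x * momentum u x t.

Lemma continuous_conformal_density : continuous_for_pos_time conformal_density.
Proof. unfold conformal_density. wave_continuity. Qed.

(** With e_t = m_x and m_t = P_x, P the pressure, the density (M + t) e + x m has
    time derivative ((M + t) m + x P)_x + (e - P), and e - P is -2 F. *)
Lemma is_derive_conformal (t : R) : 0 < t ->
  is_derive (slice M conformal_density) t (-2 * slice M (potential_density p u) t).
Proof.
  intros ht.
  rewrite <- (slice_scal M (-2) (potential_density p u) t)
    by (easy || apply continuous_potential_density).
  apply (is_derive_slice M conformal_density
    (fun x t => (M + t) * momentum u x t + x * pressure p u x t)
    (fun x t => (M + t) * (dx (dt u) x t * dx u x t + dt u x t * dx (dx u) x t)
                + pressure p u x t + x * pressure_x x t)); try easy.
  - apply continuous_conformal_density.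
  - wave_continuity.
  - wave_continuity.
  - intros x s hs hx. unfold conformal_density, energy, momentum.
    rewrite supported_kinetic, supported_potential_density,
      (cone_wave_ux _ _ _ hu) by easy. ring.
  - intros x s hs hx. unfold pressure, momentum.
    rewrite supported_kinetic, supported_potential_density,
      (cone_wave_ux _ _ _ hu) by easy. ring.
  - intros x s hs hx. rewrite supported_potential_density by easy. ring.
  - intros x s hs.
    assert (h1 := is_derive_energy_t x s hs). assert (h2 := is_derive_momentum_t x s hs).
    evar_last.
    + apply (is_derive_plus (V := R_NormedModule)
        (fun s => (M + s) * energy p u x s) (fun s => x * momentum u x s)).
      * apply (is_derive_mult (fun s => M + s) (fun s => energy p u x s) s 1);
          [auto_derive; easy|exact h1|intros; apply Rmult_comm].
      * apply (is_derive_scal (fun s => momentum u x s)). exact h2.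
    + unfold plus, mult, pressure, energy; simpl. unfold mult; simpl. ring.
  - intros x s hs.
    assert (h1 := is_derive_momentum_x x s hs). assert (h2 := is_derive_pressure_x x s hs).
    evar_last.
    + apply (is_derive_plus (V := R_NormedModule)
        (fun y => (M + s) * momentum u y s) (fun y => y * pressure p u y s)).
      * apply (is_derive_scal (fun y => momentum u y s)). exact h1.
      * apply (is_derive_mult (fun y => y) (fun y => pressure p u y s) x 1);
          [apply (is_derive_id (x : R_AbsRing))|exact h2|intros; apply Rmult_comm].
    + unfold plus, mult; simpl. unfold mult; simpl. ring.
Qed.

Lemma conformal_lower_bound (t : R) : 0 < t ->
  - (M + t) * slice M (potential_density p u) t <= slice M conformal_density t.
Proof.
  intros ht.
  rewrite <- (slice_scal M (- (M + t)) (potential_density p u) t)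
    by (easy || apply continuous_potential_density).
  apply slice_le; try easy.
  - wave_continuity.
  - apply continuous_conformal_density.
  - intros x hx. unfold conformal_density, energy, momentum, kinetic.
    apply Rabs_le_between in hx.
    set (a := dt u x t). set (b := dx u x t).
    assert (h1 : 0 <= (M + t - x) * (a - b) ^ 2)
      by (apply Rmult_le_pos; [lra|apply pow2_ge_0]).
    assert (h2 : 0 <= (M + t + x) * (a + b) ^ 2)
      by (apply Rmult_le_pos; [lra|apply pow2_ge_0]).
    nra.
Qed.

(** * Growth along outgoing characteristics *)

(** With sigma = t - s x and tau = t + s x, this is exp(- sigma) times a cutoff of
    tau: decreasing in sigma, nondecreasing in tau, zero for tau <= t1, and bounded
    by exp(M) inside the cone, where sigma >= - M. *)
Definition weight (s t1 x t : R) : R := exp (s * x - t) * ramp (t + s * x - t1).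

Definition weighted_density (s t1 x t : R) : R :=
  weight s t1 x t * (potential_density p u x t - char_deriv s u x t ^ 2 / 2).

Definition weighted_gain (s t1 x t : R) : R :=
  exp (s * x - t) * (2 * ramp' (t + s * x - t1) * potential_density p u x t
                     + ramp (t + s * x - t1) * char_deriv s u x t ^ 2).

Lemma continuous_exp_phase (s : R) : continuous_for_pos_time (fun x t => exp (s * x - t)).
Proof.
  apply continuous_comp_pos_time.
  - intros v. apply derivable_continuous_pt, derivable_pt_exp.
  - intros y r hr. continuity_2d.
Qed.

Lemma continuous_ramp_phase (s t1 : R) :
  continuous_for_pos_time (fun x t => ramp (t + s * x - t1)).
Proof.
  apply continuous_comp_pos_time; [apply continuity_pt_ramp|].
  intros y r hr. continuity_2d.
Qed.

Lemma continuous_ramp'_phase (s t1 : R) :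
  continuous_for_pos_time (fun x t => ramp' (t + s * x - t1)).
Proof.
  apply continuous_comp_pos_time; [apply continuity_pt_ramp'|].
  intros y r hr. continuity_2d.
Qed.

Ltac weighted_continuity s t1 :=
  let y := fresh "y" in let r := fresh "r" in let hr := fresh "hr" in
  intros y r hr;
  assert (ce := continuous_exp_phase s y r hr);
  assert (cr := continuous_ramp_phase s t1 y r hr);
  assert (cr' := continuous_ramp'_phase s t1 y r hr);
  unfold weighted_gain, weighted_density, weight;
  wave_continuity_at y r hr.

Lemma continuous_weighted_density (s t1 : R) : continuous_for_pos_time (weighted_density s t1).
Proof. weighted_continuity s t1. Qed.

Lemma continuous_weighted_gain (s t1 : R) : continuous_for_pos_time (weighted_gain s t1).
Proof. weighted_continuity s t1. Qed.

Lemma supported_char_deriv (s : R) : cone_supported M (char_deriv s u).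
Proof.
  intros x t ht hx. unfold char_deriv.
  rewrite (cone_wave_ux _ _ _ hu), (cone_wave_ut _ _ _ hu) by easy. ring.
Qed.

Lemma supported_weighted_gain (s t1 : R) : cone_supported M (weighted_gain s t1).
Proof.
  intros x t ht hx. unfold weighted_gain.
  rewrite supported_potential_density, supported_char_deriv by easy. ring.
Qed.

Lemma is_derive_weight (f g : R -> R) (f' g' r : R) :
  is_derive f r f' -> is_derive g r g' ->
  is_derive (fun r => exp (f r) * ramp (g r)) r
    (exp (f r) * (f' * ramp (g r) + g' * ramp' (g r))).
Proof.
  intros hf hg. evar_last.
  - apply (is_derive_mult (fun r => exp (f r)) (fun r => ramp (g r))).
    + apply (is_derive_comp exp f); [apply is_derive_exp|exact hf].
    + apply (is_derive_comp ramp g); [apply is_derive_ramp|exact hg].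
    + intros; apply Rmult_comm.
  - unfold plus, mult, scal; simpl. unfold mult; simpl. ring.
Qed.

Lemma is_derive_half_sqr (a : R -> R) (a' r : R) : is_derive a r a' ->
  is_derive (fun r => a r ^ 2 / 2) r (a r * a').
Proof.
  intros h. apply (is_derive_ext (fun r => (a r ^ 2 + 0 ^ 2) / 2)).
  - intros r'. apply (f_equal (fun z => z / 2)). simpl. ring.
  - replace (a r * a') with (a r * a' + 0 * 0) by ring.
    apply (is_derive_kinetic a (fun _ => 0)); [easy|].
    apply (is_derive_const (V := R_NormedModule)).
Qed.

(** With a = u_t + s u_x, the null form of the equation gives
    (F - a^2/2)_t = - s (F + a^2/2)_x.  Multiplying by a weight alpha(sigma)
    beta(tau) and collecting the derivatives of the weight leaves the source
    2 alpha beta' F - alpha' beta a^2, which is nonnegative because alpha decreases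
    and beta increases. *)
Lemma is_derive_weighted_density (s t1 t : R) : s * s = 1 -> 0 < t ->
  is_derive (slice M (weighted_density s t1)) t (slice M (weighted_gain s t1) t).
Proof.
  intros hs ht.
  apply (is_derive_slice M (weighted_density s t1)
    (fun x t => - s * (weight s t1 x t *
                 (potential_density p u x t + char_deriv s u x t ^ 2 / 2)))
    (fun x t => - s *
      (exp (s * x - t) * (s * ramp (t + s * x - t1) + s * ramp' (t + s * x - t1))
         * (potential_density p u x t + char_deriv s u x t ^ 2 / 2)
       + weight s t1 x t *
         (nonlinearity p (u x t) * dx u x t
          + char_deriv s u x t * (dx (dt u) x t + s * dx (dx u) x t)))));
    try easy.
  - apply continuous_weighted_density.
  - weighted_continuity s t1.
  - apply continuous_weighted_gain.
  - intros x r hr hx. unfold weighted_density.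
    rewrite supported_potential_density, supported_char_deriv by easy. lra.
  - intros x r hr hx.
    rewrite supported_potential_density, supported_char_deriv by easy. lra.
  - apply supported_weighted_gain.
  - intros x r hr.
    assert (hW : is_derive (fun r => weight s t1 x r) r
      (exp (s * x - r) * (-1 * ramp (r + s * x - t1) + 1 * ramp' (r + s * x - t1)))).
    { apply (is_derive_weight (fun r => s * x - r) (fun r => r + s * x - t1));
        auto_derive; easy || ring. }
    assert (hP := is_derive_potential_t x r hr).
    assert (hA := is_derive_half_sqr _ _ _ (is_derive_char_deriv_t p s x r u hw hr)).
    evar_last.
    + exact (is_derive_Rmult _ _ _ _ _ hW
        (is_derive_minus (V := R_NormedModule) _ _ _ _ _ hP hA)).
    + rewrite (wave_eq p u hw) by easy.
      unfold weighted_gain, weight, char_deriv, plus, mult, minus, opp; simpl.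
      unfold mult, plus; simpl.
      (* The two sides differ by a multiple of s^2 - 1. *)
      field [hs].
  - intros x r hr.
    assert (hW : is_derive (fun y => weight s t1 y r) x
      (exp (s * x - r) * (s * ramp (r + s * x - t1) + s * ramp' (r + s * x - t1)))).
    { apply (is_derive_weight (fun y => s * y - r) (fun y => r + s * y - t1));
        auto_derive; easy || ring. }
    assert (hP := is_derive_potential_x x r hr).
    assert (hA := is_derive_half_sqr _ _ _ (is_derive_char_deriv_x p s x r u hw hr)).
    apply (is_derive_scal (fun y => weight s t1 y r * (potential_density p u y r
          + char_deriv s u y r ^ 2 / 2))).
    exact (is_derive_Rmult _ _ _ _ _ hW
      (is_derive_plus (V := R_NormedModule) _ _ _ _ _ hP hA)).
Qed.

Lemma weighted_gain_ge_0 (s t1 x t : R) : 0 <= weighted_gain s t1 x t.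
Proof.
  assert (h1 := ramp'_ge_0 (t + s * x - t1)).
  assert (h2 := ramp_bounds (t + s * x - t1)).
  assert (h3 := potential_density_ge_0 x t).
  apply Rmult_le_pos; [apply Rlt_le, exp_pos|].
  apply Rplus_le_le_0_compat; apply Rmult_le_pos; [lra|easy|easy|apply pow2_ge_0].
Qed.

Lemma weighted_density_le (s t1 t : R) : s * s = 1 -> 0 < t ->
  slice M (weighted_density s t1) t <= exp M * slice M (potential_density p u) t.
Proof.
  intros hs ht. rewrite <- slice_scal by (easy || apply continuous_potential_density).
  apply slice_le; try easy.
  - apply continuous_weighted_density.
  - wave_continuity.
  - intros x hx. unfold weighted_density, weight.
    assert (h1 := ramp_bounds (t + s * x - t1)).
    assert (h2 := potential_density_ge_0 x t).
    assert (h3 : exp (s * x - t) <= exp M).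
    { apply Rnot_lt_le. intros h. apply exp_lt_inv in h.
      assert (h' := abs_sign_mult_le s x (M + t) hs hx). lra. }
    assert (h4 := exp_pos (s * x - t)).
    assert (h5 := pow2_ge_0 (char_deriv s u x t)).
    apply Rle_trans with
      (exp (s * x - t) * ramp (t + s * x - t1) * potential_density p u x t).
    + apply Rmult_le_compat_l; [|lra]. apply Rmult_le_pos; lra.
    + apply Rmult_le_compat_r; [easy|].
      assert (h6 := Rmult_le_compat _ _ _ _ (Rlt_le _ _ h4) (proj1 h1) h3 (proj2 h1)).
      lra.
Qed.

(** Let Z be the integral of the weighted density for a threshold t1 strictly
    between M and t0 + s x0.  At the time (t1 - M) / 2 the whole slice lies in the
    region where the weight is zero, so Z starts from 0; it never decreases, and
    strictly increases when the slice meets the point (x0, t0).  Afterwards Z is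
    bounded below by a positive constant, and Z is at most exp(M) times the
    integral of the potential. *)
Lemma potential_persists (s x0 t0 : R) : s * s = 1 -> 0 < t0 -> M < t0 + s * x0 ->
  u x0 t0 <> 0 ->
  exists c T0, 0 < c /\ 0 < T0 /\
    forall t, T0 <= t -> c <= slice M (potential_density p u) t.
Proof.
  intros hs ht0 hx0 hne.
  assert (hin : s * x0 <= M + t0).
  { apply abs_sign_mult_le; [easy|]. apply Rlt_le, Rnot_le_lt. intros h.
    apply hne. now apply (cone_wave_u _ _ _ hu). }
  (* Lying strictly between M and the value of tau at (x0, t0) makes the time [ts]
     positive and the gain positive at (x0, t0). *)
  set (t1 := (M + (t0 + s * x0)) / 2).
  set (ts := (t1 - M) / 2).
  assert (hts : 0 < ts < t0) by (unfold ts, t1; lra).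
  set (Z := slice M (weighted_density s t1)).
  assert (dZ : forall t, 0 < t -> is_derive Z t (slice M (weighted_gain s t1) t))
    by (intros; now apply is_derive_weighted_density).
  assert (mono : forall a b, 0 < a -> a <= b -> Z a <= Z b).
  { intros a b ha hab. apply (derivative_ge_0_le Z (slice M (weighted_gain s t1)));
      [easy| |].
    - intros r hr. apply dZ. lra.
    - intros r hr. apply slice_ge_0; [easy|lra|apply continuous_weighted_gain|].
      intros x _. apply weighted_gain_ge_0. }
  assert (Z0 : Z ts = 0).
  { transitivity (slice M (fun _ _ => 0) ts); [|apply slice_0].
    apply RInt_ext. intros x. rewrite Rmin_left, Rmax_right by lra. intros hx.
    unfold weighted_density, weight. rewrite ramp_le_0; [simpl; ring|].
    assert (h := abs_sign_mult_le s x (M + ts) hs).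
    rewrite Rabs_le_between in h. unfold ts in *. lra. }
  assert (gain : 0 < slice M (weighted_gain s t1) t0).
  { apply (slice_gt_0 M _ t0 x0); try easy.
    - apply continuous_weighted_gain.
    - apply supported_weighted_gain.
    - intros x. apply weighted_gain_ge_0.
    - assert (h1 : 0 < ramp' (t0 + s * x0 - t1)) by (apply ramp'_gt_0; unfold t1; lra).
      assert (h2 := proj1 (ramp_bounds (t0 + s * x0 - t1))).
      assert (h3 : 0 < potential_density p u x0 t0) by now apply potential_gt_0.
      apply Rmult_lt_0_compat; [apply exp_pos|].
      apply Rplus_lt_le_0_compat.
      + apply Rmult_lt_0_compat; [lra|easy].
      + apply Rmult_le_pos; [easy|apply pow2_ge_0]. }
  set (l := slice M (weighted_gain s t1) t0) in gain.
  assert (hinc : exists h, 0 < h /\ Z t0 < Z (t0 + h)).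
  { assert (hd := proj1 (is_derive_Reals _ _ _) (dZ t0 ht0)). fold l in hd.
    destruct (hd l gain) as [d hdd]. assert (hd0 := cond_pos d).
    exists (d / 2). split; [lra|].
    assert (h := hdd (d / 2)). rewrite Rabs_pos_eq in h by lra.
    assert (h' := h ltac:(lra) ltac:(lra)). apply Rabs_lt_between in h'.
    assert (0 < (Z (t0 + d / 2) - Z t0) / (d / 2)) by lra.
    apply Rdiv_pos_cases in H. lra. }
  destruct hinc as (h & hh & hZ).
  assert (hE := exp_pos M).
  assert (hpos : 0 < Z (t0 + h)).
  { assert (h0 := mono ts t0). lra. }
  exists (Z (t0 + h) / exp M), (t0 + h). repeat split.
  - now apply Rdiv_lt_0_compat.
  - lra.
  - intros t ht. apply Rle_div_l; [easy|]. rewrite Rmult_comm.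
    apply Rle_trans with (Z t); [apply mono; lra|].
    apply weighted_density_le; [easy|lra].
Qed.

(** A potential integral that stays above a positive constant would drive the
    integral of [conformal_density], whose derivative is -2 times the potential
    integral, to minus infinity. *)
Lemma vanishes_of_conformal_ge_0 :
  (forall t, 0 < t -> 0 <= slice M conformal_density t) ->
  forall x t, M < t -> u x t = 0.
Proof.
  intros hQ.
  assert (main : forall s x t, s * s = 1 -> 0 < t -> M < t + s * x -> u x t = 0).
  { intros s x0 t0 hs ht0 hx0.
    destruct (Req_dec (u x0 t0) 0) as [|hne]; [easy|exfalso].
    destruct (potential_persists s x0 t0) as (c & T0 & hc & hT0 & hlow); try easy.
    (* By then a decay at rate c has made the quantity negative. *)
  set (T1 := T0 + slice M conformal_density T0 / c + 1).
    assert (hT : T0 <= T1).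
    { assert (h := Rdiv_le_0_compat _ _ (hQ T0 hT0) hc). unfold T1. lra. }
    assert (hdec : - (slice M conformal_density T0 + c * T0)
                   <= - (slice M conformal_density T1 + c * T1)).
    { apply (derivative_ge_0_le (fun t => - (slice M conformal_density t + c * t))
        (fun t => - (-2 * slice M (potential_density p u) t + c))); [easy| |].
      - intros t ht. apply (is_derive_opp (V := R_NormedModule)
          (fun t => slice M conformal_density t + c * t)).
        apply (is_derive_plus (V := R_NormedModule)).
        + apply is_derive_conformal. lra.
        + auto_derive; [easy|ring].
      - intros t ht. assert (h := hlow t (proj1 ht)). lra. }
    assert (h := hQ T1 ltac:(lra)).
    assert (e : c * T1 = c * T0 + slice M conformal_density T0 + c).
    { unfold T1. field. lra. }
    lra. }
  intros x t ht. assert (ht0 : 0 < t) by lra.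
  destruct (Rle_lt_dec 0 x).
  - apply (main 1); lra.
  - apply (main (-1)); lra.
Qed.

(** * Backward uniqueness *)

Lemma continuous_sqr : continuous_for_pos_time (fun x t => u x t ^ 2).
Proof. wave_continuity. Qed.

Lemma is_derive_mass (t : R) : 0 < t ->
  is_derive (slice M (fun x t => u x t ^ 2)) t
    (slice M (fun x t => 2 * (u x t * dt u x t)) t).
Proof.
  intros ht.
  apply (is_derive_slice M _ (fun _ _ => 0) (fun _ _ => 0)); try easy.
  - apply continuous_sqr.
  - wave_continuity.
  - wave_continuity.
  - intros x s hs hx. rewrite (cone_wave_u _ _ _ hu) by easy. ring.
  - intros x s hs hx. rewrite (cone_wave_u _ _ _ hu) by easy. ring.
  - intros x s hs. evar_last.
    + apply (is_derive_pow (fun r => u x r) 2 s (dt u x s)).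
      now apply (wave_dt p u hw).
    + simpl. ring.
  - intros x s hs. apply (is_derive_const (V := R_NormedModule)).
Qed.

(** The conserved energy is 0, because it is 0 at late times. *)
Lemma kinetic_eq_potential_of_late_vanishing :
  (forall x t, M < t -> u x t = 0) -> forall t, 0 < t ->
  slice M (kinetic u) t = slice M (potential_density p u) t.
Proof.
  intros hz t ht.
  assert (e0 : slice M (energy p u) (M + 1) = 0).
  { transitivity (slice M (fun _ _ => 0) (M + 1)); [|apply slice_0].
    apply RInt_ext. intros x _. unfold energy, kinetic, potential_density, dx, dt.
    rewrite hz, potential_0 by lra.
    rewrite (Derive_ext (fun y => u y (M + 1)) (fun _ => 0)) by (intros; apply hz; lra).
    rewrite (Derive_ext_loc (fun r => u x r) (fun _ => 0)).
    - rewrite !Derive_const. simpl. field.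
    - apply (filter_imp (fun r => M < r)); [intros; now apply hz|].
      apply (open_gt M). lra. }
  assert (e1 : slice M (energy p u) t = 0).
  { rewrite (energy_conserved t ht), <- (energy_conserved (M + 1)); lra. }
  transitivity (slice M (fun x t => energy p u x t + potential_density p u x t) t).
  - apply RInt_ext. intros x _. unfold energy. simpl. ring.
  - rewrite slice_plus; [lra|easy|wave_continuity|apply continuous_potential_density].
Qed.

(** Backward Gronwall argument for y, the integral of u^2: since
    2 |u u_t| <= u^2 + u_t^2, y' is at least - y minus twice the kinetic energy,
    which equals the potential energy and is at most C y as u is bounded on a
    compact set. *)
Lemma vanishes_of_late_vanishing :
  (forall x t, M < t -> u x t = 0) -> forall x t, 0 < t -> u x t = 0.
Proof.
  intros hz x0 t0 ht0.
  destruct (Rlt_le_dec M t0) as [h|ht0M]; [now apply hz|].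
  destruct (Req_dec (u x0 t0) 0) as [|hne]; [easy|exfalso].
  destruct (continuity_2d_pt_bounded u (- (M + (M + 1))) (M + (M + 1)) t0 (M + 1))
    as [B hB].
  { intros x t _ ht. apply (wave_cont p u hw). lra. }
  set (C := Rpower (B) (p - 1)).
  set (y := slice M (fun x t => u x t ^ 2)).
  assert (hpot : forall t, t0 <= t <= M + 1 ->
            slice M (potential_density p u) t <= C * y t).
  { intros t ht. unfold y.
    rewrite <- (slice_scal M C (fun x t => u x t ^ 2)) by (lra || apply continuous_sqr).
    apply slice_le; [easy|lra|apply continuous_potential_density|wave_continuity|].
    intros x hx. apply Rabs_le_between in hx. apply potential_le; [easy|].
    apply hB; lra. }
  assert (hdy : forall t, t0 <= t <= M + 1 ->
            - (1 + 2 * C) * y t <= slice M (fun x t => 2 * (u x t * dt u x t)) t).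
  { intros t ht. assert (ht' : 0 < t) by lra.
    apply Rle_trans with (slice M (fun x t => -1 * u x t ^ 2 + -2 * kinetic u x t) t).
    - rewrite slice_plus, (slice_scal M (-1) (fun x t => u x t ^ 2)),
        (slice_scal M (-2)); try (easy || apply continuous_kinetic || wave_continuity).
      rewrite kinetic_eq_potential_of_late_vanishing by easy.
      assert (h := hpot t ht). fold y. lra.
    - apply slice_le; try easy; [|wave_continuity|].
      + assert (h := continuous_sqr). wave_continuity.
      + intros x _. unfold kinetic.
        assert (h1 := pow2_ge_0 (u x t + dt u x t)).
        assert (h2 := pow2_ge_0 (dx u x t)). nra. }
  assert (hy1 : y (M + 1) = 0).
  { transitivity (slice M (fun _ _ => 0) (M + 1)); [|apply slice_0].
    apply RInt_ext. intros x _. rewrite hz by lra. simpl. ring. }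
  assert (hmono : y t0 * exp ((1 + 2 * C) * t0)
                  <= y (M + 1) * exp ((1 + 2 * C) * (M + 1))).
  { set (l := 1 + 2 * C) in *.
    apply (derivative_ge_0_le (fun t => y t * exp (l * t)) (fun t =>
      slice M (fun x t => 2 * (u x t * dt u x t)) t * exp (l * t)
      + y t * (l * exp (l * t)))); [lra| |].
    - intros t ht. apply (is_derive_Rmult y (fun t => exp (l * t))).
      + apply is_derive_mass. lra.
      + auto_derive; [easy|ring].
    - intros t ht. assert (h := hdy t ht). assert (he := exp_pos (l * t)). nra. }
  assert (hpos : 0 < y t0).
  { apply (slice_gt_0 M _ t0 x0); try easy.
    - apply continuous_sqr.
    - intros x t ht hx. rewrite (cone_wave_u _ _ _ hu) by easy. ring.
    - intros x. apply pow2_ge_0.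
    - now apply pow2_gt_0. }
  rewrite hy1, Rmult_0_l in hmono.
  assert (he := exp_pos ((1 + 2 * C) * t0)). nra.
Qed.

(** * Divergence of the energy norm *)

(** By [conformal_lower_bound] the derivative of - Q / (M + t)^2 is nonnegative,
    where Q is the integral of [conformal_density]; hence - Q grows at least
    quadratically, and the same bound gives linear growth of the potential
    integral. *)
Lemma potential_unbounded_of_conformal_lt_0 (t1 : R) : 0 < t1 ->
  slice M conformal_density t1 < 0 ->
  exists c, 0 < c /\
    forall t, t1 <= t -> c * (M + t) <= slice M (potential_density p u) t.
Proof.
  intros ht1 hneg.
  exists (- slice M conformal_density t1 / (M + t1) ^ 2).
  split; [apply Rdiv_lt_0_compat; nra|]. intros t ht.
  set (q t := - slice M conformal_density t / (M + t) ^ 2).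
  assert (hq : q t1 <= q t).
  { apply (derivative_ge_0_le q (fun t =>
      2 * (slice M conformal_density t + (M + t) * slice M (potential_density p u) t)
        / (M + t) ^ 3)); [easy| |].
    - intros r hr.
      apply (is_derive_ext (fun r => slice M conformal_density r * - / (M + r) ^ 2)).
      + intros z. unfold q, Rdiv. simpl. ring.
      + evar_last.
        * apply (is_derive_Rmult (slice M conformal_density) (fun r => - / (M + r) ^ 2)
            (-2 * slice M (potential_density p u) r) (2 / (M + r) ^ 3)).
          -- apply is_derive_conformal. lra.
          -- auto_derive; [nra|field; lra].
        * simpl. field. lra.
    - intros r hr. assert (h := conformal_lower_bound r ltac:(lra)).
      apply Rle_div_r; [apply pow_lt; lra|lra]. }
  fold (q t1).
  apply Rle_trans with (q t * (M + t)); [apply Rmult_le_compat_r; lra|].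
  unfold q. replace (- slice M conformal_density t / (M + t) ^ 2 * (M + t))
    with (- slice M conformal_density t / (M + t)) by (field; lra).
  apply Rle_div_l; [lra|].
  assert (h := conformal_lower_bound t ltac:(lra)). lra.
Qed.

Lemma energy_density_kinetic (t x : R) :
  energy_density (fun x => u x t) (fun x => dt u x t) x = 2 * kinetic u x t.
Proof.
  unfold energy_density, kinetic. rewrite !pow2_abs.
  change (Derive (fun x => u x t) x) with (dx u x t). field.
Qed.

Lemma is_RInt_gen_energy_density (t : R) : 0 < t ->
  is_RInt_gen (energy_density (fun x => u x t) (fun x => dt u x t))
    (Rbar_locally m_infty) (Rbar_locally p_infty) (2 * slice M (kinetic u) t).
Proof.
  intros ht P hP. apply Filter_prod with (fun a => a < - (M + t)) (fun b => M + t < b).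
  - now exists (- (M + t)).
  - now exists (M + t).
  - intros a b ha hb. exists (2 * slice M (kinetic u) t).
    split; [|now apply locally_singleton].
    apply (is_RInt_ext (fun x => 2 * kinetic u x t)).
    { intros x _. now rewrite energy_density_kinetic. }
    rewrite <- (RInt_slice M a b) by
      (easy || apply continuous_kinetic || apply supported_kinetic || lra).
    apply (is_RInt_scal (V := R_NormedModule) (fun x => kinetic u x t)).
    apply (RInt_correct (V := R_CompleteNormedModule)).
    apply ex_RInt_slice; [apply continuous_kinetic|easy].
Qed.

Lemma energy_norm_kinetic (t : R) : 0 < t ->
  energy_norm (fun x => u x t) (fun x => dt u x t) = sqrt (2 * slice M (kinetic u) t).
Proof.
  intros ht. unfold energy_norm. f_equal.
  apply is_RInt_gen_unique. now apply is_RInt_gen_energy_density.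
Qed.

Lemma energy_norm_diverges (c t1 : R) : 0 < c -> 0 < t1 ->
  (forall t, t1 <= t -> c * (M + t) <= slice M (potential_density p u) t) ->
  is_lim (fun t => energy_norm (fun x => u x t) (fun x => dt u x t)) p_infty p_infty.
Proof.
  intros hc ht1 hlow. apply is_lim_spec. intros A.
  set (E := slice M (energy p u) 1).
  exists (Rmax t1 ((A ^ 2 / 2 - E) / c)). intros t ht.
  assert (h1 := Rmax_l t1 ((A ^ 2 / 2 - E) / c)).
  assert (h2 := Rmax_r t1 ((A ^ 2 / 2 - E) / c)).
  assert (ht0 : 0 < t) by lra.
  rewrite energy_norm_kinetic by easy.
  assert (hk : slice M (kinetic u) t = E + slice M (potential_density p u) t).
  { unfold E. rewrite <- (energy_conserved t ht0).
    rewrite <- slice_plus by (easy || apply continuous_potential_density || wave_continuity).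
    apply RInt_ext. intros x _. unfold energy. simpl. ring. }
  assert (h3 := hlow t ltac:(lra)).
  assert (h4 : A ^ 2 / 2 - E < t * c) by (apply Rlt_div_l; lra).
  eapply Rle_lt_trans; [apply Rle_abs|].
  rewrite <- sqrt_Rsqr_abs. apply sqrt_lt_1_alt. split; [apply Rle_0_sqr|].
  rewrite hk. unfold Rsqr. nra.
Qed.

End ConeWaves.

Lemma initial_limit_of_vanishing (w : R -> R -> R) (x l : R) :
  initial_limit w x l -> (forall t, 0 < t -> w x t = 0) -> l = 0.
Proof.
  intros hl hw. apply Rminus_diag_uniq_sym, Rabs_eq_0.
  apply Rle_antisym; [|apply Rabs_pos].
  apply Rle_plus_epsilon. intros eps heps.
  assert (h01 : Rabs 0 <= 1) by (rewrite Rabs_R0; lra).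
  destruct (initial_limit_along w x 0 l h01 hl eps heps) as (d & hd & h).
  specialize (h (d / 2) ltac:(lra)).
  rewrite Rmult_0_l, Rplus_0_r, hw in h by lra. lra.
Qed.

Theorem corollary2p6 (p : R) (u0 u1 : R -> R) (T : Rbar) (u : R -> R -> R)
  (hp : 1 < p)
  (hu0 : smooth u0) (hu0c : compactly_supported u0)
  (hu1 : smooth u1) (hu1c : compactly_supported u1)
  (hnz : exists x : R, u0 x <> 0 \/ u1 x <> 0)
  (hu : is_maximal_solution p u0 u1 T u) :
  Rbar_lt T p_infty \/
  (T = p_infty /\
   (forall t : R, 0 < t -> finite_energy (fun x => u x t) (fun x => dt u x t)) /\
   is_lim (fun t => energy_norm (fun x => u x t) (fun x => dt u x t))
     p_infty p_infty).
Proof.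
  destruct hu as [hsol _].
  destruct T as [T| |]; [now left| |now left].
  right. split; [easy|].
  destruct hu0c as [M0 hM0]. destruct hu1c as [M1 hM1].
  set (m := Rmax 0 (Rmax M0 M1)).
  assert (m0 : 0 <= m) by apply Rmax_l.
  assert (mM : Rmax M0 M1 <= m) by apply Rmax_r.
  assert (mM0 := Rmax_l M0 M1). assert (mM1 := Rmax_r M0 M1).
  assert (hw : cone_wave p (m + 1) u).
  { apply (solution_cone_wave p m u0 u1); try easy.
    - intros x hx. apply hM0. lra.
    - intros x hx. apply hM1. lra. }
  split.
  { intros t ht. eexists. now apply (is_RInt_gen_energy_density p (m + 1)). }
  destruct (classic (exists t, 0 < t /\ slice (m + 1) (conformal_density p (m + 1) u) t < 0))
    as [[t1 [ht1 hneg]]|hpos].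
  - destruct (potential_unbounded_of_conformal_lt_0 p (m + 1) u hw t1 ht1 hneg)
      as (c & hc & hlow).
    now apply (energy_norm_diverges p (m + 1) u hw c t1).
  - exfalso.
    assert (hz : forall x t, 0 < t -> u x t = 0).
    { apply (vanishes_of_late_vanishing p (m + 1) u hw).
      apply (vanishes_of_conformal_ge_0 p (m + 1) u hw).
      intros t ht. apply Rnot_lt_le. intros h. apply hpos. now exists t. }
    destruct hnz as [x [h|h]]; apply h.
    + apply (initial_limit_of_vanishing u x); [apply (solution_u_lim _ _ _ _ _ hsol)|].
      intros t ht. now apply hz.
    + apply (initial_limit_of_vanishing (dt u) x);
        [apply (solution_ut_lim _ _ _ _ _ hsol)|].
      intros t ht. unfold dt. rewrite <- (Derive_const 0 t).
      apply Derive_ext_loc. apply (filter_imp (fun s => 0 < s)); [|now apply open_gt].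
      intros s hs. now apply hz.
Qed.
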